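(* Let $u:\Omega\to[0,\tau_0]$ be a parallel refractor from $\Omega$ to $\Sigma$, let $x^*\in\Omega$, $X^*=(x^*,u(x^* ))$, and suppose that the target $\Sigma$ is regular from $X^*$. Let $\sigma$ be a Radon measure on $\Sigma$ satisfying the following two growth conditions. (i) There exist a neighborhood $\mathcal U_{X^*}$ of $X^*$ and constants $\tilde C>0$, $\mu_0>0$ depending only on $X^*$ such that for all $\bar Y,\hat Y\in\Sigma$, all $Z\in\mathcal U_{X^*}$ and all $0<\mu\le\mu_0$, $$\sigma\left[\mathcal N_\mu\left(\left\{Y(\lambda)\in[\bar Y,\hat Y]_Z:\lambda\in\left[\tfrac14,\tfrac34\right]\right\}\right)\cap\Sigma\right]\ge\tilde C\,\mu^{n-1}|\bar Y-\hat Y|.$$ (ii) There exist constants $C_0>0$ and $1\le q<\frac{n}{n-1}$ such that $\sigma(F_u(B_\eta))\le C_0\,\eta^{n/q}$ for all balls $B_\eta\subset\subset\Omega$ of radius $\eta$. Then there exist $\delta,M,C_2>0$ depending on $X^*$, and positive constants $C_1=C_1(C_0,\tilde C,M)$ and $\alpha=\alpha(n,q)$, such that if $\bar x,\hat x\in B_{\delta/2}(x^* )$, $\bar Y\in F_u(\bar x)$ and $\hat Y\in F_u(\hat x)$ satisfy $$|\bar Y-\hat Y|\ge\max\left\{1,\left(\tfrac{2M}{\delta}\right)^2,\left(\tfrac{2M}{C_2}\right)^2\right\}|\bar x-\hat x|,$$ then $$|\bar Y-\hat Y|\le C_1|\bar x-\hat x|^\alpha .$$ Moreover, $u\in C^{1,\alpha}(B_{\delta/2}(x^*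 ))$. The exponent can be taken to be $$\alpha=\frac{\frac{n}{2q}-\frac{n-1}{2}}{1+\frac32(n-1)+\frac{n}{2q}}.$$
   Context: **Setting.** Points of $\mathbb R^{n+1}$ are written $X=(x,x_{n+1})$, $Y=(y,y_{n+1})$. Fix $\kappa>1$. $\Omega\subset\mathbb R^n$ is a bounded convex domain (the source, in $\{x_{n+1}=0\}$), and the target $\Sigma$ is a compact hypersurface in $\mathbb R^{n+1}$ with $\Sigma\subset\mathbb R^n\times[\tau_1,\tau_1+\omega]$, $\tau_1,\omega>0$. Let $\Delta=\max_{y\in\pi(\Sigma)}\mathrm{diam}(\Omega\cup\{y\})$, where $\pi(\Sigma)$ is the projection of $\Sigma$ on $\mathbb R^n$. Let $0<\tau_0<\tau_1$ and $\mathcal C_\Omega=\Omega\times[0,\tau_0]$. Standing assumptions: $\tau_1>\Delta/\sqrt{\kappa^2-1}$; $\tau_1\ge\max\{\kappa\tau_0,\ \tau_0+\frac{\kappa\Delta}{\kappa-1}\}$; and $e_{n+1}\cdot\frac{Y-X}{|Y-X|}\ge\frac1\kappa$ for all $X\in\mathcal C_\Omega$, $Y\in\Sigma$. **Hyperboloids.** For $b>0$, $$\phi_{Y,b}(x)=y_{n+1}-\frac{\kappa b}{\kappa^2-1}-\sqrt{\frac{b^2}{(\kappa^2-1)^2}+\frac{|x-y|^2}{\kappa^2-1}}.$$ Let $c(X,Y)=\kappa(y_{n+1}-x_{n+1})-|X-Y|$ (positive for $X\in\mathcal C_\Omega$, $Y\in\Sigma$) and $\phi(x,Y,X_0)=\phi_{Y,c(X_0,Y)}(x)$;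 its graph passes through $X_0$. **Refractor.** $u:\Omega\to[0,\tau_0]$ is a parallel refractor from $\Omega$ to $\Sigma$ if $u>0$ and for each $x_0\in\Omega$ there are $Y\in\Sigma$ and $0<b<\kappa y_{n+1}-\sqrt{y_{n+1}^2+\Delta^2}$ such that $u(x)\ge\phi_{Y,b}(x)$ for all $x\in\Omega$, with equality at $x=x_0$. For $x_0\in\Omega$ and $X_0=(x_0,u(x_0))$, $F_u(x_0)=\{Y\in\Sigma: u(x)\ge\phi(x,Y,X_0)\ \forall x\in\Omega\}$, and $F_u(S)=\bigcup_{x\in S}F_u(x)$ for $S\subset\Omega$. **Directions and parametrization of the target.** For $v\in\mathbb R^n$ with $|v|\le1/\sqrt{\kappa^2-1}$ put $Q(v)=\frac{\kappa-\sqrt{1-(\kappa^2-1)|v|^2}}{1+|v|^2}$ and $\Lambda(v)=(Q(v)v,\,-Q(v)+\kappa)$, a unit vector. If $Y=X_0+s\Lambda(v)$ with $s>0$, then $v=D_x\phi(x_0,Y,X_0)$. It is assumed that for each $X\in\mathcal C_\Omega$ every $Y\in\Sigma$ can be written $Y=X+s_X(\Lambda)\Lambda$ with $|\Lambda|=1$, where $s_X(\Lambda)>0$ is a Lipschitz function of $\Lambda$ (so each ray from $X$ meets $\Sigma$ in at most one point). For $\bar Y,\hat Y\in\Sigma$ and $Z=(z,z_{n+1})\in\mathcal C_\Omega$, let $\bar v=D_x\phi(z,\bar Y,Z)$, $\hat v=D_x\phi(z,\hat Y,Z)$, $v(\lambda)=(1-\lambda)\bar v+\lambda\hat v$, $Y(\lambda)=Y_Z(\lambda)=Z+s_Z(\Lambda(v(\lambda)))\Lambda(v(\lambda))$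 for $\lambda\in[0,1]$, and $[\bar Y,\hat Y]_Z=\Sigma\cap\{Z+s\Lambda(v(\lambda)):s>0,\lambda\in[0,1]\}$. The function $s_Z$ is understood to be defined at these directions, with $Y_Z(\lambda)\in\Sigma$ for $\lambda\in[0,1]$. **Regularity of the target.** $\Sigma$ is regular from $X_0\in\mathcal C_\Omega$ if there are a neighborhood $U_{X_0}$ of $X_0$ and constants $c_1,c_2>0$ depending on $U_{X_0}$ such that for all $\bar Y,\hat Y\in\Sigma$ and $Z=(z,z_{n+1})\in U_{X_0}$, $$\phi(x,Y_Z(\lambda),Z)\le\max\{\phi(x,\bar Y,Z),\phi(x,\hat Y,Z)\}-c_1|\bar Y-\hat Y|^2|x-z|^2$$ for all $x\in\Omega$ with $|x-z|\le c_2$ and all $\lambda\in[\frac14,\frac34]$. $\mathcal N_\mu(S)$ denotes the $\mu$-neighborhood of a set $S$. *)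

(* Defs.v *)
From HB Require Import structures.
From mathcomp Require Import all_boot all_order all_algebra.
From mathcomp Require Import all_classical all_reals all_analysis.
Import Order.TTheory GRing.Theory Num.Theory.
Import numFieldNormedType.Exports.

Set Implicit Arguments.
Unset Strict Implicit.
Unset Printing Implicit Defensive.

Local Open Scope classical_set_scope.
Local Open Scope ring_scope.

(* R^{n+1}, whose points are written X = (X.1, X.2) = (x, x_{n+1}). *)
Notation ambient R n := ('rV[R]_n * R)%type.

(* The library norms on 'rV[R]_n and on products are sup norms; distances are
   measured with the Euclidean norms below. Both norms give the same topology,
   so open, compact, nbhs, bounded_set and differentiable are the library's. *)
Section euclidean.
Context {R : realType} {n : nat}.
Implicit Types (x y : 'rV[R]_n) (X Y : ambient R n).

Definition enorm x : R := Num.sqrt (\sum_(i < n) x 0 i ^+ 2).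

Definition enormX X : R := Num.sqrt (enorm X.1 ^+ 2 + X.2 ^+ 2).

Definition eball x (r : R) : set 'rV[R]_n := [set y | enorm (y - x) < r].

Definition ediam (A : set 'rV[R]_n) : R :=
  sup [set d | exists x y, [/\ A x, A y & d = enorm (x - y)]].

Definition eneigh (mu : R) (S : set (ambient R n)) : set (ambient R n) :=
  [set X | exists2 Y, S Y & enormX (X - Y) < mu].

Definition compactly_contained (A B : set 'rV[R]_n) :=
  compact (closure A) /\ closure A `<=` B.

Definition grad (f : 'rV[R]_n -> R) x : 'rV[R]_n :=
  \row_(i < n) 'D_(delta_mx 0 i) f x.

(* f is C^{1,a} on the open set A. For 0 < a, continuity of the gradient
   follows from its Hoelder bound. *)
Definition C1_holder (a : R) (A : set 'rV[R]_n) (f : 'rV[R]_n -> R) :=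
  (forall x, A x -> differentiable f x) /\
  exists K : R, forall x y, A x -> A y ->
    enorm (grad f x - grad f y) <= K * enorm (x - y) `^ a.

(* Embedded topological n-dimensional submanifold of R^{n+1}, possibly with
   boundary: the charts take values in relatively open subsets of the
   half-spaces {w | 0 <= w_i}. *)
Definition hypersurface (S : set (ambient R n)) :=
  forall P, S P ->
  exists (U : set (ambient R n)) (W : set 'rV[R]_n) (i : 'I_n)
         (h : ambient R n -> 'rV[R]_n) (g : 'rV[R]_n -> ambient R n),
    let H := W `&` [set w | 0 <= w 0 i] in
    [/\ open U /\ U P, open W,
        set_bij (S `&` U) H h, (forall X, (S `&` U) X -> g (h X) = X) &
        {within S `&` U, continuous h} /\ {within H, continuous g}].

End euclidean.

Notation borel R n := (g_sigma_algebraType (@open (ambient R n))).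

Section radon.
Context {R : realType} {n : nat}.
Implicit Types mu : {measure set (borel R n) -> \bar R}.

Definition radon mu :=
  [/\ forall K : set (ambient R n), compact K -> (mu K < +oo)%E,
      forall A : set (borel R n), measurable A ->
        mu A = ereal_inf [set mu U | U in
                           [set U : set (ambient R n) | open U /\ A `<=` U]]
    & forall U : set (ambient R n), open U ->
        mu U = ereal_sup [set mu K | K in
                           [set K : set (ambient R n) | compact K /\ K `<=` U]]].

(* A Radon measure on the closed set S, seen as a measure on the whole space
   that does not charge the complement of S. *)
Definition radon_on (S : set (ambient R n)) mu := radon mu /\ mu (~` S) = 0%E.

End radon.

Section refractor.
Context {R : realType} {n : nat}.
Implicit Types (kappa tau omega : R) (Omega : set 'rV[R]_n)
  (Sigma : set (ambient R n)) (u : 'rV[R]_n -> R) (X Y Z : ambient R n)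
  (s : ambient R n -> ambient R n -> R).

(* The supremum is a maximum, since Sigma is compact. *)
Definition Delta Omega Sigma : R :=
  sup [set ediam (Omega `|` [set Y.1]) | Y in Sigma].

Definition cylinder Omega tau0 : set (ambient R n) :=
  [set X | Omega X.1 /\ 0 <= X.2 <= tau0].

Definition hyperboloid kappa Y (b : R) (x : 'rV[R]_n) : R :=
  Y.2 - kappa * b / (kappa ^+ 2 - 1)
  - Num.sqrt (b ^+ 2 / (kappa ^+ 2 - 1) ^+ 2
              + enorm (x - Y.1) ^+ 2 / (kappa ^+ 2 - 1)).

Definition cost kappa X Y : R := kappa * (Y.2 - X.2) - enormX (X - Y).

Definition phi kappa (x : 'rV[R]_n) Y X0 : R :=
  hyperboloid kappa Y (cost kappa X0 Y) x.

Definition parallel_refractor kappa tau0 Omega Sigma u :=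
  (forall x, Omega x -> 0 < u x <= tau0) /\
  forall x0, Omega x0 -> exists Y (b : R),
    [/\ Sigma Y,
        0 < b < kappa * Y.2 - Num.sqrt (Y.2 ^+ 2 + Delta Omega Sigma ^+ 2),
        forall x, Omega x -> hyperboloid kappa Y b x <= u x
      & u x0 = hyperboloid kappa Y b x0].

Definition refractor_map kappa Omega Sigma u (x0 : 'rV[R]_n) :
    set (ambient R n) :=
  [set Y | Sigma Y /\ forall x, Omega x -> phi kappa x Y (x0, u x0) <= u x].

Definition refractor_image kappa Omega Sigma u (S : set 'rV[R]_n) :
    set (ambient R n) :=
  \bigcup_(x in S) refractor_map kappa Omega Sigma u x.

Definition dirQ kappa (v : 'rV[R]_n) : R :=
  (kappa - Num.sqrt (1 - (kappa ^+ 2 - 1) * enorm v ^+ 2))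
  / (1 + enorm v ^+ 2).

Definition Lambda kappa (v : 'rV[R]_n) : ambient R n :=
  (dirQ kappa v *: v, kappa - dirQ kappa v).

Definition ray X (t : R) (L : ambient R n) : ambient R n :=
  (X.1 + t *: L.1, X.2 + t * L.2).

Definition directions Sigma X : set (ambient R n) :=
  [set L | enormX L = 1 /\ exists2 t : R, 0 < t & Sigma (ray X t L)].

Definition vpath kappa Ybar Yhat Z (lambda : R) : 'rV[R]_n :=
  (1 - lambda) *: grad (fun x => phi kappa x Ybar Z) Z.1
  + lambda *: grad (fun x => phi kappa x Yhat Z) Z.1.

Definition Ypath kappa s Ybar Yhat Z (lambda : R) : ambient R n :=
  let L := Lambda kappa (vpath kappa Ybar Yhat Z lambda) in ray Z (s Z L) L.

Definition target_segment kappa Sigma Ybar Yhat Z : set (ambient R n) :=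
  Sigma `&` [set Y | exists t lambda : R, [/\ 0 < t, 0 <= lambda <= 1 &
    Y = ray Z t (Lambda kappa (vpath kappa Ybar Yhat Z lambda))]].

Definition middle_segment kappa Sigma s Ybar Yhat Z : set (ambient R n) :=
  [set Y | target_segment kappa Sigma Ybar Yhat Z Y /\
    exists2 lambda : R, 4^-1 <= lambda <= 3 / 4 &
      Y = Ypath kappa s Ybar Yhat Z lambda].

(* s X L is the parameter s_X(L); it is only meaningful for X in the cylinder
   and L in directions Sigma X. *)
Record setting kappa tau0 tau1 omega Omega Sigma s : Prop := Setting {
  kappa_gt1 : 1 < kappa;
  tau0_gt0 : 0 < tau0;
  tau0_lt_tau1 : tau0 < tau1;
  omega_gt0 : 0 < omega;
  source_open : open Omega;
  source_nonempty : Omega !=set0;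
  source_bounded : bounded_set Omega;
  source_convex : convex_set (Omega : set (convex_lmodType 'rV[R]_n));
  target_compact : compact Sigma;
  target_hypersurface : hypersurface Sigma;
  target_strip : forall Y, Sigma Y -> tau1 <= Y.2 <= tau1 + omega;
  tau1_gt : Delta Omega Sigma / Num.sqrt (kappa ^+ 2 - 1) < tau1;
  tau1_ge : Num.max (kappa * tau0)
    (tau0 + kappa * Delta Omega Sigma / (kappa - 1)) <= tau1;
  target_visible : forall X Y, cylinder Omega tau0 X -> Sigma Y ->
    kappa^-1 <= (Y.2 - X.2) / enormX (Y - X);
  target_param : forall X, cylinder Omega tau0 X -> forall Y, Sigma Y ->
    exists L, [/\ enormX L = 1, 0 < s X L & Y = ray X (s X L) L];
  param_lipschitz : forall X, cylinder Omega tau0 X ->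
    exists K : R, forall L L', directions Sigma X L -> directions Sigma X L' ->
      `|s X L - s X L'| <= K * enormX (L - L');
  param_path : forall Ybar Yhat Z (lambda : R), Sigma Ybar -> Sigma Yhat ->
    cylinder Omega tau0 Z -> 0 <= lambda <= 1 ->
    0 < s Z (Lambda kappa (vpath kappa Ybar Yhat Z lambda)) /\
    Sigma (Ypath kappa s Ybar Yhat Z lambda)
}.

(* Ypath is only defined for Z in the cylinder, whence the intersection of the
   neighborhood with it, here and in target_growth. *)
Definition regular_from kappa tau0 Omega Sigma s X0 :=
  exists (U : set (ambient R n)) (c1 c2 : R), [/\ nbhs X0 U, 0 < c1, 0 < c2 &
    forall Ybar Yhat Z x (lambda : R), Sigma Ybar -> Sigma Yhat ->
      U Z -> cylinder Omega tau0 Z ->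
      Omega x -> enorm (x - Z.1) <= c2 -> 4^-1 <= lambda <= 3 / 4 ->
      phi kappa x (Ypath kappa s Ybar Yhat Z lambda) Z <=
        Num.max (phi kappa x Ybar Z) (phi kappa x Yhat Z)
        - c1 * enormX (Ybar - Yhat) ^+ 2 * enorm (x - Z.1) ^+ 2].

Definition target_growth kappa tau0 Omega Sigma s
    (sigma : {measure set (borel R n) -> \bar R})
    (U : set (ambient R n)) (Ct mu0 : R) :=
  forall Ybar Yhat Z (mu : R), Sigma Ybar -> Sigma Yhat ->
    U Z -> cylinder Omega tau0 Z -> 0 < mu <= mu0 ->
    ((Ct * mu ^+ (n - 1) * enormX (Ybar - Yhat))%:E <=
     sigma (eneigh mu (middle_segment kappa Sigma s Ybar Yhat Z) `&` Sigma))%E.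

Definition source_growth kappa Omega Sigma u
    (sigma : {measure set (borel R n) -> \bar R}) (C0 q : R) :=
  forall (x : 'rV[R]_n) (eta : R), 0 < eta ->
    compactly_contained (eball x eta) Omega ->
    (sigma (refractor_image kappa Omega Sigma u (eball x eta)) <=
     (C0 * eta `^ (n%:R / q))%:E)%E.

End refractor.

Definition holder_exponent {R : realType} (n : nat) (q : R) : R :=
  (n%:R / (2 * q) - (n%:R - 1) / 2)
  / (1 + 3 / 2 * (n%:R - 1) + n%:R / (2 * q)).

(* Main.v *)
Require Import Defs.
From HB Require Import structures.
From mathcomp Require Import all_boot all_order all_algebra.
From mathcomp Require Import all_classical all_reals all_analysis.
From mathcomp Require Import ring lra.
Import Order.TTheory GRing.Theory Num.Theory.
Import numFieldNormedType.Exports.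

Set Implicit Arguments.
Unset Strict Implicit.
Unset Printing Implicit Defensive.

Local Open Scope classical_set_scope.
Local Open Scope ring_scope.

(** Fix Z in the cylinder and Y in the target, and put V = Y - Z,
    q = kappa |V| - V_{n+1}, v = V' / q (which is D_x phi(z, Y, Z)),
    theta = 1 / (2 q). All the quadrics c(., Y) = const have the same quadratic
    part, so that squaring c(Z + (w, h), Y) = c(Z, Y) gives
    h - v.w + theta P(w, h) = 0 with P = |w|^2 - (kappa^2 - 1) h^2
    independent of Y. Hence everything is governed by the pair (v, theta), and
    regularity from X*, read off a second-order expansion in a direction
    orthogonal to the segment of slopes, says exactly that theta is strictly
    concave along that segment, with a gain c1 |Ybar - Yhat|^2. Since P is
    comparable to |w|^2 on the graph of u, the local condition gives a gap on
    the whole of Omega.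

    Let d = |Ybar - Yhat| and let r be the distance of the two base points.
    At a point Z where the supporting hyperboloids of the two base points cross,
    semiconvexity gives u(z) - z_{n+1} <= C d r. With eta = M (r / d)^(1/2) and
    mu = d^2 eta / M, the gap at distance >= eta from z absorbs this height and
    the error of moving Y(lambda) by mu, so every target point within mu of the
    middle of the segment belongs to F_u(B_{2 eta}(z)): it supports u at the
    point where the cost towards it is maximal. Comparing sigma-measures yields
    Ct mu^(n-1) d <= C0 (2 eta)^(n/q), which is the Hoelder estimate. *)

(** * Euclidean norms *)

Section euclid.
Context {R : realType} {n : nat}.
Implicit Types (x y z : 'rV[R]_n) (V W : ambient R n).

Definition dot x y : R := \sum_(i < n) x 0 i * y 0 i.

Lemma dotC x y : dot x y = dot y x.
Proof. by apply: eq_bigr => i _; rewrite mulrC. Qed.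

Lemma dotDl x y z : dot (x + y) z = dot x z + dot y z.
Proof. by rewrite -big_split; apply: eq_bigr => i _; rewrite mxE mulrDl. Qed.

Lemma dotZl a x z : dot (a *: x) z = a * dot x z.
Proof. by rewrite mulr_sumr; apply: eq_bigr => i _; rewrite mxE mulrA. Qed.

Lemma dotNl x z : dot (- x) z = - dot x z.
Proof. by rewrite -scaleN1r dotZl mulN1r. Qed.

Lemma dotBl x y z : dot (x - y) z = dot x z - dot y z.
Proof. by rewrite dotDl dotNl. Qed.

Lemma dotDr x y z : dot z (x + y) = dot z x + dot z y.
Proof. by rewrite dotC dotDl !(dotC z). Qed.

Lemma dotZr a x z : dot z (a *: x) = a * dot z x.
Proof. by rewrite dotC dotZl dotC. Qed.

Lemma dotNr x z : dot z (- x) = - dot z x.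
Proof. by rewrite dotC dotNl dotC. Qed.

Lemma dotBr x y z : dot z (x - y) = dot z x - dot z y.
Proof. by rewrite dotDr dotNr. Qed.

Definition dotE := (dotDl, dotDr, dotNl, dotNr, dotZl, dotZr).

Lemma dot_ge0 x : 0 <= dot x x.
Proof. by apply: sumr_ge0 => i _; rewrite -expr2 sqr_ge0. Qed.

Lemma dot_eq0 x : dot x x = 0 -> x = 0.
Proof.
move=> /eqP; rewrite psumr_eq0 => [/allP x0|i _]; last by rewrite -expr2 sqr_ge0.
apply/rowP => i; rewrite mxE; apply/eqP.
by have := x0 i (mem_index_enum i); rewrite mulf_eq0 orbb.
Qed.

Lemma enorm_sqr x : enorm x ^+ 2 = dot x x.
Proof.
rewrite /enorm sqr_sqrtr; first by apply: eq_bigr => i _; rewrite expr2.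
by apply: sumr_ge0 => i _; rewrite sqr_ge0.
Qed.

Lemma enorm_ge0 x : 0 <= enorm x.
Proof. exact: sqrtr_ge0. Qed.

Lemma enorm0 : enorm (0 : 'rV[R]_n) = 0.
Proof.
by apply/eqP; rewrite -sqrf_eq0 enorm_sqr -(scale0r 0) dotZl mul0r.
Qed.

Lemma enorm_eq0 x : enorm x = 0 -> x = 0.
Proof. by move=> x0; apply: dot_eq0; rewrite -enorm_sqr x0 expr0n. Qed.

Lemma enormZ a x : enorm (a *: x) = `|a| * enorm x.
Proof.
apply/eqP; rewrite -(eqrXn2 (n := 2)) ?mulr_ge0 ?enorm_ge0//.
by rewrite exprMn !enorm_sqr dotZl dotZr mulrA real_normK ?num_real// expr2.
Qed.

Lemma enormN x : enorm (- x) = enorm x.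
Proof. by rewrite -scaleN1r enormZ normrN1 mul1r. Qed.

Lemma enormB x y : enorm (x - y) = enorm (y - x).
Proof. by rewrite -enormN opprB. Qed.

(** Cauchy-Schwarz: the square of [(y.y) x - (x.y) y] is [y.y] times the difference of the two
    sides. *)
Lemma dot_sqr_le x y : dot x y ^+ 2 <= dot x x * dot y y.
Proof.
have [y0|y0] := eqVneq (dot y y) 0.
  by rewrite (dot_eq0 y0) -(scale0r 0) !dotZr !mul0r mulr0 expr0n.
have yp : 0 < dot y y by rewrite lt_def y0 dot_ge0.
have := dot_ge0 (dot y y *: x - dot x y *: y).
rewrite !dotE (dotC y x) => h.
rewrite -subr_ge0 -(pmulr_rge0 _ yp); apply: le_trans h _.
by apply/eqP/eqP; rewrite le_eqVlt; apply/orP; left; apply/eqP; ring.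
Qed.

Lemma dot_le x y : `|dot x y| <= enorm x * enorm y.
Proof.
rewrite -(@ler_pXn2r _ 2) ?nnegrE ?mulr_ge0 ?enorm_ge0//.
by rewrite exprMn !enorm_sqr real_normK ?num_real// dot_sqr_le.
Qed.

Lemma enormD x y : enorm (x + y) <= enorm x + enorm y.
Proof.
rewrite -(@ler_pXn2r _ 2) ?nnegrE ?addr_ge0 ?enorm_ge0//.
rewrite enorm_sqr !dotE (dotC y x) -!enorm_sqr.
have := le_trans (ler_norm _) (dot_le x y); lra.
Qed.

Lemma enorm_triangle x y z : enorm (x - z) <= enorm (x - y) + enorm (y - z).
Proof. by rewrite -(subrKA y) enormD. Qed.

Lemma enormX_sqr V : enormX V ^+ 2 = dot V.1 V.1 + V.2 ^+ 2.
Proof. by rewrite sqr_sqrtr ?addr_ge0 ?sqr_ge0// enorm_sqr. Qed.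

Lemma enormX_ge0 V : 0 <= enormX V.
Proof. exact: sqrtr_ge0. Qed.

Lemma enorm_le_enormX V : enorm V.1 <= enormX V.
Proof.
rewrite -(@ler_pXn2r _ 2) ?nnegrE ?enorm_ge0 ?enormX_ge0//.
by rewrite enorm_sqr enormX_sqr lerDl sqr_ge0.
Qed.

Lemma snd_le_enormX V : `|V.2| <= enormX V.
Proof.
rewrite -(@ler_pXn2r _ 2) ?nnegrE ?enormX_ge0//.
by rewrite enormX_sqr real_normK ?num_real// lerDr dot_ge0.
Qed.

Lemma enormX_le V : enormX V <= enorm V.1 + `|V.2|.
Proof.
rewrite -(@ler_pXn2r _ 2) ?nnegrE ?addr_ge0 ?enorm_ge0 ?enormX_ge0//.
rewrite enormX_sqr sqrrD enorm_sqr real_normK ?num_real//.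
by rewrite lerD2r lerDl mulrn_wge0// mulr_ge0 ?enorm_ge0.
Qed.

Lemma enormXN V : enormX (- V) = enormX V.
Proof. by rewrite /enormX /= enormN sqrrN. Qed.

Lemma enormXB V W : enormX (V - W) = enormX (W - V).
Proof. by rewrite -enormXN opprB. Qed.

Lemma enormXD V W : enormX (V + W) <= enormX V + enormX W.
Proof.
rewrite -(@ler_pXn2r _ 2) ?nnegrE ?addr_ge0 ?enormX_ge0//.
rewrite sqrrD !enormX_sqr /= !dotE (dotC W.1).
suff : dot V.1 W.1 + V.2 * W.2 <= enormX V * enormX W by lra.
apply: le_trans (ler_norm _) _.
rewrite -(@ler_pXn2r _ 2) ?nnegrE ?mulr_ge0 ?enormX_ge0//.
rewrite exprMn !enormX_sqr real_normK ?num_real//.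
have := dot_sqr_le V.1 W.1.
have := dot_ge0 (W.2 *: V.1 - V.2 *: W.1).
rewrite !dotE (dotC W.1 V.1); lra.
Qed.

Lemma enormX_dist V W : `|enormX V - enormX W| <= enormX (V - W).
Proof.
rewrite ler_norml; apply/andP; split.
  have := enormXD (W - V) V; rewrite subrK enormXB; lra.
by have := enormXD (V - W) W; rewrite subrK; lra.
Qed.

Lemma norm_le_enorm x : `|x| <= enorm x.
Proof.
rewrite /Num.norm/= mx_normrE; apply: bigmax_le; first exact: enorm_ge0.
move=> [i j] _ /=; rewrite (ord1 i).
rewrite -(@ler_pXn2r _ 2) ?nnegrE ?enorm_ge0// real_normK ?num_real//.
rewrite enorm_sqr /dot (bigD1 j)//= -expr2 lerDl.
by apply: sumr_ge0 => l _; rewrite -expr2 sqr_ge0.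
Qed.

Lemma enorm_continuous : continuous (@enorm R n).
Proof.
move=> x; apply: continuous_comp; last exact: sqrt_continuous.
apply: (@continuous_big _ _ +%R 0 (fun=> true) _ _ (index_enum 'I_n)
  (fun i x => x 0 i ^+ 2)) => [y|i _]; first exact: add_continuous.
move=> y; apply: (@continuous_comp _ _ _ (fun x : 'rV[R]_n => x 0 i) (fun a : R => a ^+ 2)).
  exact: coord_continuous.
exact: exprn_continuous.
Qed.

Lemma enormX_continuous : continuous (@enormX R n).
Proof.
move=> V; apply: continuous_comp; last exact: sqrt_continuous.
apply: cvgD.
  apply: (@continuous_comp _ _ _ (fun V : ambient R n => enorm V.1)
    (fun a : R => a ^+ 2)); last exact: exprn_continuous.
  apply: (@continuous_comp _ _ _ fst (@enorm R n)); first exact: cvg_fst.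
  exact: enorm_continuous.
apply: (@continuous_comp _ _ _ snd (fun a : R => a ^+ 2)); first exact: cvg_snd.
exact: exprn_continuous.
Qed.

End euclid.

(** * Topology, gradients and costs *)

Section topology.
Context {R : realType} {n : nat}.
Implicit Types (x y v w : 'rV[R]_n).

Lemma enorm_le_norm x : enorm x <= Num.sqrt n%:R * `|x|.
Proof.
rewrite -(@ler_pXn2r _ 2) ?nnegrE ?mulr_ge0 ?sqrtr_ge0 ?enorm_ge0//.
rewrite exprMn enorm_sqr sqr_sqrtr //.
have -> : n%:R * `|x| ^+ 2 = \sum_(i < n) `|x| ^+ 2.
  by rewrite sumr_const card_ord mulr_natl.
apply: ler_sum => i _; rewrite -expr2 -real_normK ?num_real//.
rewrite lerXn2r ?nnegrE//.
rewrite [leRHS]/Num.norm/= mx_normrE.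
exact: (le_bigmax _ (fun ij => `|x ij.1 ij.2|) (0, i)).
Qed.

Lemma open_eball_sub (A : set 'rV[R]_n) x : open A -> A x ->
  exists2 r : R, 0 < r & eball x r `<=` A.
Proof.
move=> oA Ax; have /nbhs_ballP[r /= r0 rA] := open_nbhs_nbhs (conj oA Ax).
exists r => // y xy; apply: rA; rewrite -ball_normE /ball_/= -normrN opprB.
exact: le_lt_trans (norm_le_enorm _) xy.
Qed.

Lemma nbhs_ambient (X : ambient R n) U : nbhs X U ->
  exists2 r : R, 0 < r & forall Z : ambient R n,
    enorm (Z.1 - X.1) < r -> `|Z.2 - X.2| < r -> U Z.
Proof.
move=> /nbhs_ballP[r /= r0 rU]; exists r => // Z Z1 Z2; apply: rU; split.
  rewrite -ball_normE /ball_/= -normrN opprB.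
  exact: le_lt_trans (norm_le_enorm _) Z1.
by rewrite -ball_normE /ball_/= -normrN opprB.
Qed.

Lemma dot_linear v : linear (dot v : 'rV[R]_n -> R^o).
Proof. by move=> a x y; rewrite dotDr dotZr. Qed.

Lemma dot_continuous v : continuous (dot v).
Proof.
apply: (@continuous_big _ _ +%R 0 (fun=> true) _ _ (index_enum 'I_n)
  (fun i x => v 0 i * x 0 i)) => [y|i _]; first exact: add_continuous.
move=> y; apply: (@continuous_comp _ _ _ (fun x : 'rV[R]_n => x 0 i)
  (fun a : R => v 0 i * a)); first exact: coord_continuous.
exact: mulrl_continuous.
Qed.

(** A first-order expansion with Euclidean remainder is one for the sup norm too, up to a factor
    [sqrt n]; uniqueness of the differential then identifies the gradient. *)
Lemma expansion_grad (f : 'rV[R]_n -> R) x v :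
  (forall e : R, 0 < e -> exists2 r : R, 0 < r & forall w, enorm w < r ->
     `|f (x + w) - f x - dot v w| <= e * enorm w) ->
  differentiable f x /\ grad f x = v.
Proof.
move=> fx.
pose df : {linear 'rV[R]_n -> R^o} :=
  HB.pack (dot v : 'rV[R]_n -> R^o) (GRing.isLinear.Build _ _ _ _ _ (dot_linear v)).
have dfc : continuous df by exact: dot_continuous.
have lo e : 0 < e -> \forall w \near (0 : 'rV[R]_n),
    `|f (x + w) - f x - dot v w| <= e * `|w|.
  (* Adding 1 keeps [C] positive even for [n = 0]. *)
  move=> e0; pose C : R := Num.sqrt n%:R + 1.
  have C0 : 0 < C by rewrite ltr_wpDl ?sqrtr_ge0.
  have [r r0 fr] := fx _ (divr_gt0 e0 C0).
  apply/nbhs_ballP; exists (r / C) => /=; first exact: divr_gt0.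
  move=> w; rewrite -ball_normE /ball_/= sub0r normrN ltr_pdivlMr// => wr.
  have wC : enorm w <= C * `|w|.
    by rewrite (le_trans (enorm_le_norm w))// ler_wpM2r// lerDl.
  rewrite (le_trans (fr w _))//; first by rewrite (le_lt_trans wC)// mulrC.
  rewrite -mulrA ler_wpM2l ?(ltW e0)//.
  by rewrite -(ler_pM2l C0) mulrA divff ?gt_eqF// mul1r.
have dfE : 'd f x = df :> ('rV[R]_n -> R^o).
  apply: diff_unique => //; apply/eqaddoP => e /lo; apply: filterS => w.
  by rewrite !fctE /= opprD addrA (addrC w).
have fd : differentiable f x.
  apply/diff_locallyP; rewrite dfE; split => //.
  apply/eqaddoP => e /lo; apply: filterS => w.
  by rewrite !fctE /= opprD addrA (addrC w).
split => //; apply/rowP => i; rewrite mxE deriveE// dfE /= /dot.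
rewrite (bigD1 i)//= big1 => [|j ji]; rewrite !mxE ?eqxx/= ?mulr1 ?addr0//.
by rewrite (negbTE ji) mulr0.
Qed.

End topology.

(** * Hyperboloids as level sets of the cost *)

Section cost.
Context {R : realType} {n : nat}.
Variable kappa : R.
Hypothesis kappa1 : 1 < kappa.
Implicit Types (x w : 'rV[R]_n) (V X Y Z : ambient R n) (b t h : R).

(** Raising the point changes the linear term by [kappa (t' - t)] and the Euclidean distance by at
    most [t' - t]. This converts differences of height into differences of cost. *)
Lemma cost_decr x t t' Y : t <= t' ->
  (kappa - 1) * (t' - t) <= cost kappa (x, t) Y - cost kappa (x, t') Y
    <= (kappa + 1) * (t' - t).
Proof.
move=> tt'; rewrite /cost /=.
have := enormX_dist ((x, t') - Y) ((x, t) - Y).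
have -> : ((x, t') - Y) - ((x, t) - Y) = (0, t' - t) :> ambient R n.
  by rewrite opprB addrA subrK -[LHS]/(x - x, t' - t) subrr.
have := enormX_le ((0, t' - t) : ambient R n).
rewrite /= enorm0 add0r ger0_norm ?subr_ge0// ler_norml => h1 h2.
by apply/andP; split; lra.
Qed.

Lemma kappa_sqr1 : 0 < kappa ^+ 2 - 1.
Proof. have := kappa1; nra. Qed.

(** Up to the positive factor [kappa ^+ 2 - 1], both inequalities have the same squared form, so
    only the signs of the quantities [A] and [B] compared with the square roots remain to be
    examined; [0 <= b] and [1 < kappa] select the right sheet. *)
Lemma hyperboloid_le Y b x t : 0 <= b ->
  (hyperboloid kappa Y b x <= t) = (cost kappa (x, t) Y <= b).
Proof.
move=> b0; rewrite /hyperboloid /cost /=.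
set S := Num.sqrt _; set N := enormX _.
have k0 := kappa_sqr1.
have S0 : 0 <= S by exact: sqrtr_ge0.
have N0 : 0 <= N by exact: enormX_ge0.
pose T := Y.2 - t; pose D := dot (x - Y.1) (x - Y.1).
have D0 : 0 <= D by exact: dot_ge0.
have SE : S ^+ 2 = b ^+ 2 / (kappa ^+ 2 - 1) ^+ 2 + D / (kappa ^+ 2 - 1).
  by rewrite sqr_sqrtr enorm_sqr// addr_ge0// divr_ge0 ?sqr_ge0// ltW.
have NE : N ^+ 2 = D + T ^+ 2 by rewrite enormX_sqr /= -[in RHS]sqrrN opprB.
pose A := T - kappa * b / (kappa ^+ 2 - 1); pose B := kappa * T - b.
have -> : (Y.2 - kappa * b / (kappa ^+ 2 - 1) - S <= t) = (A <= S).
  by rewrite /A /T; apply/idP/idP; lra.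
have -> : (kappa * (Y.2 - t) - N <= b) = (B <= N).
  by rewrite /B /T; apply/idP/idP; lra.
have key : (kappa ^+ 2 - 1) * (S ^+ 2 - A ^+ 2) = N ^+ 2 - B ^+ 2.
  by rewrite SE NE /A /B; field; lra.
have AE : (kappa ^+ 2 - 1) * A = (kappa ^+ 2 - 1) * T - kappa * b.
  by rewrite /A; field; lra.
have kp := kappa1.
apply/idP/idP => [AS|BN].
  rewrite leNgt; apply/negP => NB.
  have B2 : 0 < B ^+ 2 - N ^+ 2 by nra.
  have [A0|A0] := leP 0 A.
    have : 0 <= S ^+ 2 - A ^+ 2 by nra.
    by move=> h; have := mulr_ge0 (ltW k0) h; lra.
  have B0 : 0 < kappa * T - b by rewrite -/B; lra.
  have T0 : 0 < T by nra.
  have kA : (kappa ^+ 2 - 1) * A < 0 by nra.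
  have : 0 <= - ((kappa ^+ 2 - 1) * A) * T by nra.
  rewrite AE => h1; have h2 := mulr_ge0 b0 (ltW B0).
  by move: B2; rewrite NE /B; nra.
rewrite leNgt; apply/negP => SA.
have A0 : 0 < A by lra.
have kA : 0 < (kappa ^+ 2 - 1) * A by rewrite mulr_gt0.
have T0 : 0 < T by rewrite AE in kA; nra.
have B0 : 0 <= B by rewrite AE in kA; rewrite /B; nra.
have h1 : 0 < A ^+ 2 - S ^+ 2 by nra.
have h2 : 0 <= N ^+ 2 - B ^+ 2 by nra.
by have := mulr_gt0 k0 h1; lra.
Qed.

(** If the cost on the graph were strictly below [b], the point could be lowered by
    [(b - cost) / (kappa + 1)] and still have cost at most [b], although it would then lie below the
    graph. *)
Lemma cost_hyperboloid Y b x : 0 <= b ->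
  cost kappa (x, hyperboloid kappa Y b x) Y = b.
Proof.
move=> b0; set p := hyperboloid _ _ _ _; apply/eqP; rewrite eq_le.
rewrite -hyperboloid_le// lexx /= leNgt; apply/negP => cb.
pose d := (b - cost kappa (x, p) Y) / (kappa + 1).
have kp := kappa1.
have d0 : 0 < d by rewrite divr_gt0//; lra.
have /(cost_decr x Y) /andP[_ h] : p - d <= p by lra.
have : p <= p - d; last by lra.
rewrite hyperboloid_le//.
apply: (@le_trans _ _ (cost kappa (x, p) Y + (kappa + 1) * d)); first lra.
by rewrite /d mulrC divfK; [lra|apply/eqP; lra].
Qed.

Lemma hyperboloid_uniq Y b x t : 0 <= b -> cost kappa (x, t) Y = b ->
  hyperboloid kappa Y b x = t.
Proof.
move=> b0 tb; apply/eqP; rewrite eq_le hyperboloid_le// tb lexx/=.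
rewrite leNgt; apply/negP => ht; have /andP[+ _] := cost_decr x Y (ltW ht).
have kp := kappa1; rewrite tb cost_hyperboloid// subrr.
by have : 0 < (kappa - 1) * (t - hyperboloid kappa Y b x); [rewrite mulr_gt0 ?subr_gt0|lra].
Qed.

End cost.

(** * The algebraic form of a cost comparison *)

Section excess.
Context {R : realType} {n : nat}.
Variable kappa : R.
Implicit Types (x w : 'rV[R]_n) (V X Y Z : ambient R n) (b t h : R).

Definition qden V : R := kappa * enormX V - V.2.
Definition slope V : 'rV[R]_n := (qden V)^-1 *: V.1.
Definition lcone w h : R := dot w w - (kappa ^+ 2 - 1) * h ^+ 2.
(** For [V = Y - Z] the sign tells the position of [Z + (w, h)] relative to the hyperboloid of focus
    [Y] through [Z]: zero on it, positive above it, as long as [kappa h] does not exceed the length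
    of [V]. *)
Definition excess V w h : R := h - dot (slope V) w + lcone w h / (2 * qden V).

(** With [X = Y - (Z + (w, h))], equality of the two costs reads [|X| = |V| - kappa h]; this is the
    difference of the squares of its sides. *)
Lemma excessE V w h X : qden V != 0 -> X.1 = V.1 - w -> X.2 = V.2 - h ->
  enormX X ^+ 2 - (enormX V - kappa * h) ^+ 2 = 2 * qden V * excess V w h.
Proof.
move=> q0 X1 X2; rewrite enormX_sqr X1 X2 /excess /lcone /slope !dotE (dotC w).
have := enormX_sqr V; move: q0; rewrite /qden => q0 NE.
by rewrite [(_ - kappa * h) ^+ 2]sqrrB NE; field.
Qed.

Lemma excess_cost_le Z Y w h : 0 < qden (Y - Z) -> 0 <= excess (Y - Z) w h ->
  cost kappa (Z.1 + w, Z.2 + h) Y <= cost kappa Z Y.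
Proof.
move=> q0 e0; rewrite /cost /= -(enormXB Y) -(enormXB Y).
set V := Y - Z in q0 e0 *.
have := @excessE V w h (Y - (Z.1 + w, Z.2 + h)).
set N := enormX (Y - _); have N0 : 0 <= N by exact: enormX_ge0.
rewrite gt_eqF// /V /= !opprD !addrA => /(_ isT erefl erefl) h1.
have h2 : 0 <= 2 * qden V * excess V w h by rewrite !mulr_ge0// ltW.
suff : enormX V - kappa * h <= N by lra.
rewrite leNgt; apply/negP => NB.
have : 0 < (enormX V - kappa * h) ^+ 2 - N ^+ 2 by nra.
by rewrite /V in h2 *; lra.
Qed.

(** The bound on [kappa * h] makes [|V| - kappa h] nonnegative, so that squaring preserves the
    inequality and the second sheet is excluded. *)
Lemma cost_le_excess Z Y w h : 0 < qden (Y - Z) ->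
  kappa * h <= enormX (Y - Z) ->
  cost kappa (Z.1 + w, Z.2 + h) Y <= cost kappa Z Y ->
  0 <= excess (Y - Z) w h.
Proof.
move=> q0 kh; rewrite /cost /= -(enormXB Y) -(enormXB Y).
set V := Y - Z in q0 kh *.
have := @excessE V w h (Y - (Z.1 + w, Z.2 + h)).
set N := enormX (Y - _); have N0 : 0 <= N by exact: enormX_ge0.
rewrite gt_eqF// /V /= !opprD !addrA => /(_ isT erefl erefl) h1 h2.
have : 0 <= 2 * qden V * excess V w h.
  by rewrite /V in kh h2 *; rewrite -h1; nra.
by rewrite pmulr_rge0// mulr_gt0.
Qed.

Lemma cost_eq_excess Z Y w h : 0 < qden (Y - Z) ->
  cost kappa (Z.1 + w, Z.2 + h) Y = cost kappa Z Y ->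
  excess (Y - Z) w h = 0.
Proof.
move=> q0; rewrite /cost /= -(enormXB Y) -(enormXB Y).
set V := Y - Z in q0 *.
have := @excessE V w h (Y - (Z.1 + w, Z.2 + h)).
set N := enormX (Y - _).
rewrite gt_eqF// /V /= !opprD !addrA => /(_ isT erefl erefl) h1 h2.
have NE : N = enormX (Y - Z) - kappa * h by lra.
move: h1; rewrite NE subrr => /esym/eqP; rewrite mulf_eq0 => /orP[|/eqP//].
by rewrite gt_eqF// mulr_gt0.
Qed.

(** A difference is the difference of squares divided by the sum, and [D] bounds that sum from
    above. *)
Lemma excess_cost_gap Z Y w h (D : R) : 0 < qden (Y - Z) -> 0 < D ->
  kappa * h <= enormX (Y - Z) -> 0 <= excess (Y - Z) w h ->
  enormX (Y - (Z.1 + w, Z.2 + h)) + (enormX (Y - Z) - kappa * h) <= D ->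
  cost kappa (Z.1 + w, Z.2 + h) Y +
    2 * qden (Y - Z) * excess (Y - Z) w h / D <= cost kappa Z Y.
Proof.
move=> q0 D0 kh e0; rewrite /cost /= -(enormXB Y) -(enormXB Y).
set V := Y - Z in q0 kh e0 *.
have := @excessE V w h (Y - (Z.1 + w, Z.2 + h)).
set N := enormX (Y - _); have N0 : 0 <= N by exact: enormX_ge0.
rewrite gt_eqF// /V /= !opprD !addrA => /(_ isT erefl erefl) h1 h2.
rewrite -h1.
suff : (N ^+ 2 - (enormX (Y - Z) - kappa * h) ^+ 2) / D <=
    N - (enormX (Y - Z) - kappa * h) by lra.
rewrite ler_pdivrMr//; move: kh h2; rewrite -subr_ge0 /V.
set S := _ - kappa * h => S0 NS.
have NS0 : S <= N.
  rewrite leNgt; apply/negP => lt; have : 0 < S ^+ 2 - N ^+ 2 by nra.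
  have h3 : 0 <= 2 * qden V * excess V w h by rewrite !mulr_ge0// ltW.
  by rewrite /V in h3; rewrite /S in h1 *; lra.
have NSD : N + S <= D by rewrite /S; lra.
have : 0 <= (N - S) * (D - (N + S)) by rewrite mulr_ge0 ?subr_ge0.
lra.
Qed.

End excess.

(** * Slope and curvature of a hyperboloid *)

Section admissible.
Context {R : realType} {n : nat}.
Variables (kappa T0 Rm b0 : R).
Hypotheses (kappa1 : 1 < kappa) (T0_gt0 : 0 < T0) (Rm_gt0 : 0 < Rm)
  (b0_gt0 : 0 < b0).
Implicit Types (v w : 'rV[R]_n) (V X Y Z : ambient R n) (t h : R).

Local Notation k := (kappa ^+ 2 - 1).
Local Notation q0 := ((kappa - 1) * T0).
Local Notation qden := (qden kappa).
Local Notation slope := (slope kappa).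
Local Notation excess := (excess kappa).
Local Notation lcone := (lcone kappa).

(** Bounds to hold uniformly for [V = Y - Z], with [Z] in the cylinder and [Y] in the target. The
    quantity bounded below by [b0] is the cost of [Y] from [Z]. *)
Definition admissible V :=
  [/\ T0 <= V.2, enormX V <= Rm & b0 <= kappa * V.2 - enormX V].

Let k_gt0 : 0 < k := kappa_sqr1 kappa1.

Let k1 : kappa - 1 != 0.
Proof. by rewrite subr_eq0 gt_eqF. Qed.

Lemma qmin_gt0 : 0 < q0.
Proof. by rewrite mulr_gt0// subr_gt0. Qed.

Lemma qden_norm_le V : (kappa - 1) * enormX V <= qden V.
Proof.
rewrite /qden mulrBl mul1r lerD2l lerN2.
exact: le_trans (ler_norm _) (snd_le_enormX V).
Qed.

Lemma qden_ge V : admissible V -> q0 <= qden V.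
Proof.
move=> [V2 _ _]; apply: le_trans (qden_norm_le V).
rewrite ler_pM2l ?subr_gt0//; apply: le_trans V2 _.
exact: le_trans (ler_norm _) (snd_le_enormX V).
Qed.

Lemma qden_gt0 V : admissible V -> 0 < qden V.
Proof. by move/qden_ge; exact: lt_le_trans qmin_gt0. Qed.

Lemma qden_le V : admissible V -> qden V <= kappa * Rm.
Proof.
move=> [V2 VR _]; rewrite /qden.
have : kappa * enormX V <= kappa * Rm by rewrite ler_pM2l// (lt_trans ltr01).
have := T0_gt0; lra.
Qed.

(** Since the numerator on the right is the cost, a positive lower bound for the cost keeps the
    slope away from its asymptotic value [(kappa^2 - 1)^(-1/2)]. *)
Lemma slope_sqr V : qden V != 0 ->
  k * enorm (slope V) ^+ 2 = 1 - ((kappa * V.2 - enormX V) / qden V) ^+ 2.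
Proof.
move=> qV; rewrite enorm_sqr /slope !dotE.
have := enormX_sqr V; move: qV; rewrite /qden => qV NE.
have -> : dot V.1 V.1 = enormX V ^+ 2 - V.2 ^+ 2 by rewrite NE addrK.
by field.
Qed.

(** Obtained from [slope_sqr] by inserting the least cost [b0] and the largest denominator
    [kappa * Rm]. *)
Definition slope_max : R := Num.sqrt ((1 - (b0 / (kappa * Rm)) ^+ 2) / k).

Lemma slope_max_ge0 : 0 <= slope_max.
Proof. exact: sqrtr_ge0. Qed.

Lemma slope_max_lt : slope_max < (Num.sqrt k)^-1.
Proof.
rewrite -sqrtrV ?(ltW k_gt0)// ltr_sqrt ?invr_gt0// ltr_pdivrMr// mulVf ?gt_eqF//.
have b1 : 0 < b0 / (kappa * Rm).
  by rewrite divr_gt0// mulr_gt0// (lt_trans ltr01).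
by have := exprn_gt0 2 b1; lra.
Qed.

Lemma slope_le V : admissible V -> enorm (slope V) <= slope_max.
Proof.
move=> aV; have qV := qden_gt0 aV.
rewrite -(ger0_norm (enorm_ge0 _)) -sqrtr_sqr ler_wsqrtr//.
rewrite ler_pdivlMr// mulrC slope_sqr ?gt_eqF// lerD2l lerN2.
have kp : 0 < kappa by rewrite (lt_trans ltr01).
have [_ _ bV] := aV; have bV0 := lt_le_trans b0_gt0 bV.
have h1 : 0 < b0 / (kappa * Rm) by rewrite divr_gt0// mulr_gt0.
have h2 : 0 < (kappa * V.2 - enormX V) / qden V by rewrite divr_gt0.
rewrite lerXn2r ?nnegrE ?(ltW h1) ?(ltW h2)// ler_pM ?(ltW b0_gt0)//.
  by rewrite invr_ge0 mulr_ge0// ltW.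
by rewrite lef_pV2 ?posrE ?mulr_gt0//; exact: qden_le.
Qed.

Lemma slope_sqr_lt1 V : admissible V -> k * enorm (slope V) ^+ 2 < 1.
Proof.
move=> aV; rewrite slope_sqr ?gt_eqF ?qden_gt0// gtrBl exprn_gt0// divr_gt0//.
  by case: aV => _ _; exact: lt_le_trans.
exact: qden_gt0.
Qed.

Lemma qden_dist V V' : `|qden V - qden V'| <= (kappa + 1) * enormX (V - V').
Proof.
have := enormX_dist V V'; have := snd_le_enormX (V - V').
rewrite /= !ler_norml /qden => /andP[h1 h2] /andP[h3 h4].
have kp := kappa1; apply/andP; split; nra.
Qed.

Lemma qdenV_dist V V' : admissible V -> admissible V' ->
  `|(qden V)^-1 - (qden V')^-1|
    <= (kappa + 1) * enormX (V - V') / (qden V * qden V').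
Proof.
move=> aV aV'; have q1 := qden_gt0 aV; have q2 := qden_gt0 aV'.
have -> : (qden V)^-1 - (qden V')^-1 = (qden V' - qden V) / (qden V * qden V').
  by field; rewrite !gt_eqF.
rewrite normrM distrC [`|_^-1|]gtr0_norm ?invr_gt0 ?mulr_gt0//.
by rewrite ler_pM2r ?qden_dist// invr_gt0 mulr_gt0.
Qed.

Definition slope_lip : R := (1 + (kappa + 1) / (kappa - 1)) / q0.
Definition theta_lip : R := (kappa + 1) / q0 ^+ 2.

Lemma slope_lip_gt0 : 0 < slope_lip.
Proof.
rewrite divr_gt0 ?qmin_gt0// addr_gt0// divr_gt0 ?subr_gt0//.
by rewrite addr_gt0// (lt_trans ltr01).
Qed.

Lemma theta_lip_gt0 : 0 < theta_lip.
Proof.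
rewrite divr_gt0 ?exprn_gt0 ?qmin_gt0//.
by rewrite addr_gt0// (lt_trans ltr01).
Qed.

Lemma slope_dist V V' : admissible V -> admissible V' ->
  enorm (slope V - slope V') <= slope_lip * enormX (V - V').
Proof.
move=> aV aV'; have q1 := qden_gt0 aV; have q2 := qden_gt0 aV'.
have -> : slope V - slope V' =
    (qden V)^-1 *: (V - V').1 + ((qden V)^-1 - (qden V')^-1) *: V'.1.
  by rewrite /slope scalerBr scalerBl addrA subrK.
apply: le_trans (enormD _ _) _; rewrite !enormZ.
have h1 : `|(qden V)^-1| * enorm (V - V').1 <= q0^-1 * enormX (V - V').
  rewrite gtr0_norm ?invr_gt0// ler_pM ?enorm_ge0 ?invr_ge0 ?(ltW q1)//.
    by rewrite lef_pV2 ?posrE ?qmin_gt0//; exact: qden_ge.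
  exact: (enorm_le_enormX (V - V')).
(* This factor [qden V'] cancels the one in the denominator of [qdenV_dist], so that the constant
   does not involve [Rm]. *)
have h2 : enorm V'.1 <= qden V' / (kappa - 1).
  rewrite ler_pdivlMr ?subr_gt0// mulrC; apply: le_trans (qden_norm_le V').
  by rewrite ler_pM2l ?subr_gt0// enorm_le_enormX.
have h3 := ler_pM (normr_ge0 _) (enorm_ge0 _) (qdenV_dist aV aV') h2.
apply: le_trans (lerD h1 h3) _.
have -> : (kappa + 1) * enormX (V - V') / (qden V * qden V') *
    (qden V' / (kappa - 1)) =
    (qden V)^-1 * ((kappa + 1) / (kappa - 1) * enormX (V - V')).
  by field; rewrite k1 ?gt_eqF.
have h4 : (qden V)^-1 <= q0^-1.
  by rewrite lef_pV2 ?posrE ?qmin_gt0//; exact: qden_ge.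
have h5 : 0 <= (kappa + 1) / (kappa - 1) * enormX (V - V').
  rewrite mulr_ge0 ?enormX_ge0// divr_ge0 ?subr_ge0 ?(ltW kappa1)//.
  by rewrite addr_ge0// (le_trans ler01) ?ltW.
have := ler_wpM2r h5 h4; rewrite /slope_lip.
by move: (_ / (kappa - 1)) q0^-1 (enormX _) (qden V)^-1 => c i N j; lra.
Qed.

Lemma theta_dist V V' : admissible V -> admissible V' ->
  `|(2 * qden V)^-1 - (2 * qden V')^-1| <= theta_lip * enormX (V - V').
Proof.
move=> aV aV'; have q1 := qden_gt0 aV; have q2 := qden_gt0 aV'.
have := qdenV_dist aV aV'; set D := enormX _ => h.
have D0 : 0 <= D by exact: enormX_ge0.
rewrite !invfM -mulrBr normrM gtr0_norm ?invr_gt0//.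
have h2 : (kappa + 1) * D / (qden V * qden V') <= theta_lip * D.
  have -> : theta_lip * D = (kappa + 1) * D / (q0 * q0).
    by rewrite /theta_lip expr2; field; rewrite !gt_eqF ?subr_gt0.
  rewrite ler_wpM2l//.
    by rewrite mulr_ge0// addr_ge0// (le_trans ler01) ?ltW.
  have q0p := qmin_gt0.
  rewrite lef_pV2 ?posrE ?mulr_gt0// ?subr_gt0//.
  by rewrite ler_pM ?(ltW q0p) ?(ltW q1)// qden_ge.
have := normr_ge0 ((qden V)^-1 - (qden V')^-1).
by move: (le_trans h h2); set a := `|_|; set b := theta_lip * D; lra.
Qed.

Lemma excess_dist V V' w h : admissible V -> admissible V' ->
  excess V w h - excess V' w h <=
    enormX (V - V') * (slope_lip * enorm w + theta_lip * `|lcone w h|).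
Proof.
move=> aV aV'; have h1 := slope_dist aV aV'; have h2 := theta_dist aV aV'.
rewrite /excess.
have -> : h - dot (slope V) w + lcone w h / (2 * qden V) -
   (h - dot (slope V') w + lcone w h / (2 * qden V')) =
   - dot (slope V - slope V') w +
   lcone w h * ((2 * qden V)^-1 - (2 * qden V')^-1) by rewrite dotBl; ring.
rewrite [leRHS]mulrDr; apply: lerD.
  apply: le_trans (ler_norm _) _; rewrite normrN.
  apply: le_trans (dot_le _ _) _; rewrite mulrA ler_wpM2r ?enorm_ge0//.
  by rewrite [leRHS]mulrC.
apply: le_trans (ler_norm _) _; rewrite normrM mulrC mulrA ler_wpM2r//.
by rewrite [leRHS]mulrC.
Qed.

(** Dropping the [h ^+ 2] term of [lcone] leaves a paraboloid; this is the source of the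
    semiconvexity of refractors. *)
Lemma excess_le V w h : admissible V ->
  excess V w h <= h - dot (slope V) w + enorm w ^+ 2 / (2 * q0).
Proof.
move=> aV; rewrite lerD2l /lcone; have q1 := qden_gt0 aV.
have h1 : dot w w - k * h ^+ 2 <= enorm w ^+ 2.
  by rewrite enorm_sqr gerBl mulr_ge0 ?sqr_ge0// ltW.
apply: (@le_trans _ _ (enorm w ^+ 2 / (2 * qden V))).
  by rewrite ler_pM2r// invr_gt0 mulr_gt0.
rewrite ler_wpM2l ?sqr_ge0// lef_pV2 ?posrE ?mulr_gt0// ?subr_gt0//.
by rewrite ler_pM2l//; exact: qden_ge.
Qed.

(* The hyperboloid is asymptotic to a cone of slope (kappa^2 - 1)^(-1/2), and
   stays uniformly away from it over bounded sets. *)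
Lemma lipschitz_slope (Wm : R) : 0 < Wm ->
  exists L0 : R, [/\ 0 < L0, k * L0 ^+ 2 < 1 &
    forall V w h, admissible V -> enorm w <= Wm -> h <= 0 ->
      0 <= excess V w h -> - h <= L0 * enorm w].
Proof.
move=> Wm0; pose a := (Num.sqrt k)^-1.
have sk0 : 0 < Num.sqrt k by rewrite sqrtr_gt0.
have a0 : 0 < a by rewrite invr_gt0.
have ka : k * a ^+ 2 = 1.
  by rewrite exprVn sqr_sqrtr ?(ltW k_gt0)// mulfV// gt_eqF.
have nu0 := slope_max_ge0; have nua := slope_max_lt; rewrite -/a in nua.
have q0p := qmin_gt0.
(* Let [a] be the asymptotic slope. A descent steeper than [a - e] makes the quadratic term at most
   [c e |w|], because [1 - k (a - e)^2 <= 2 k a e]. The linear term then has to gain more than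
   [(a - e - slope_max) |w|], and the choice [e (1 + c) = a - slope_max] makes this impossible. *)
pose c := Wm / q0 * k * a; have c0 : 0 < c by rewrite !mulr_gt0 ?invr_gt0.
pose e := (a - slope_max) / (1 + c).
have ce : e * (1 + c) = a - slope_max by rewrite divfK// gt_eqF// addr_gt0.
have e0 : 0 < e by rewrite divr_gt0 ?subr_gt0// addr_gt0.
have ea : e < a by nra.
exists (a - e); split; first by rewrite subr_gt0.
  have : k * (a - e) ^+ 2 < k * a ^+ 2 by rewrite ltr_pM2l//; nra.
  by rewrite ka.
move=> V w h aV wW h0 ex; rewrite leNgt; apply/negP => gh.
have q1 := qden_gt0 aV.
have w0 := enorm_ge0 w; set W := enorm w in wW gh w0 *.
pose th := (2 * qden V)^-1.
have th0 : 0 < th by rewrite invr_gt0 mulr_gt0.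
have thq : th * (2 * q0) <= 1.
  rewrite mulrC ler_pdivrMr ?mulr_gt0// mul1r ler_pM2l//; exact: qden_ge.
have sw : - dot (slope V) w <= slope_max * W.
  apply: le_trans (ler_norm _) _; rewrite normrN.
  apply: le_trans (dot_le _ _) _; rewrite ler_wpM2r//; exact: slope_le.
move: ex; rewrite /excess /lcone -enorm_sqr -/W -/th => ex.
set L := a - e in gh.
have L0 : 0 < L by rewrite subr_gt0.
have LW : 0 <= L * W by rewrite mulr_ge0// ltW.
have h2 : (L * W) ^+ 2 <= h ^+ 2 by nra.
have h3 := ler_wpM2l (ltW th0) (ler_wpM2l (ltW k_gt0) h2).
have h4 : (L - slope_max) * W < th * W ^+ 2 * (1 - k * L ^+ 2). 
  by move: gh ex sw h3; move: (dot _ w) (th) (L) (slope_max) => d th' L' m; lra.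
have kL : 1 - k * L ^+ 2 <= 2 * k * a * e.
  have := mulr_ge0 (ltW k_gt0) (sqr_ge0 e); move: ka; rewrite /L.
  by move: (k) (e) (a) => K E A; lra.
have h5 : th * W ^+ 2 * (1 - k * L ^+ 2) <= th * W ^+ 2 * (2 * k * a * e).
  by rewrite ler_wpM2l// mulr_ge0 ?sqr_ge0// ltW.
have h6 : th * W <= Wm / (2 * q0).
  rewrite ler_pdivlMr ?mulr_gt0// ?subr_gt0//.
  have := ler_wpM2r w0 thq; move: (th) (W) (q0) wW => t W' q; lra.
have kae : 0 <= W * (2 * k * a * e).
  apply: mulr_ge0 => //; apply: mulr_ge0; last exact: ltW.
  by apply: mulr_ge0; [apply: mulr_ge0; [|exact: ltW]|exact: ltW].
have h7 := ler_wpM2r kae h6.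
have : Wm / (2 * q0) * (W * (2 * k * a * e)) = c * e * W.
  by rewrite /c; field; rewrite !gt_eqF ?subr_gt0.
move=> h8; have h9 : (L - slope_max) * W < c * e * W by lra.
have : e * (1 + c) * W = (a - slope_max) * W by rewrite ce.
by move: h9; rewrite /L; move: (e) (c) (a) slope_max (W) => E C A m X; lra.
Qed.

End admissible.

(** * Unit directions and their slopes *)

Section direction.
Context {R : realType} {n : nat}.
Variables (kappa : R).
Hypothesis (kappa1 : 1 < kappa).
Implicit Types (v w : 'rV[R]_n) (V X Y Z L : ambient R n) (t h : R).
Local Notation k := (kappa ^+ 2 - 1).

Lemma dirQ_gt0 v : 0 < dirQ kappa v.
Proof.
have w0 : 0 <= enorm v ^+ 2 by rewrite sqr_ge0.
have kp := kappa1.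
have kw := mulr_ge0 (ltW (kappa_sqr1 kp)) w0.
apply: divr_gt0; last by rewrite ltr_pwDl.
rewrite subr_gt0 -[ltRHS]gtr0_norm ?(lt_trans ltr01)//.
by rewrite -sqrtr_sqr ltr_sqrt; nra.
Qed.

(** [dirQ kappa v] is the smaller root of [(1 + |v|^2) Q^2 - 2 kappa Q + kappa^2 - 1 = 0], which
    says that [(Q v, kappa - Q)] is a unit vector; the bound on [v] makes the discriminant
    nonnegative. *)
Lemma Lambda_unit v : k * enorm v ^+ 2 <= 1 -> enormX (Lambda kappa v) = 1.
Proof.
move=> kv; apply/eqP; rewrite -(eqrXn2 (n := 2)) ?enormX_ge0//.
rewrite enormX_sqr /= !dotE -enorm_sqr expr1n; apply/eqP.
rewrite /dirQ; set S := Num.sqrt _; set W := enorm v in kv S *.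
have SE : S ^+ 2 = 1 - k * W ^+ 2 by rewrite sqr_sqrtr ?subr_ge0.
have W0 : 1 + W ^+ 2 != 0 by rewrite gt_eqF// ltr_wpDr ?sqr_ge0.
have -> : (kappa - S) / (1 + W ^+ 2) * ((kappa - S) / (1 + W ^+ 2) * W ^+ 2) +
  (kappa - (kappa - S) / (1 + W ^+ 2)) ^+ 2 =
  kappa ^+ 2 + (- kappa ^+ 2 + S ^+ 2) / (1 + W ^+ 2) by field.
by rewrite SE; field.
Qed.

(** On the ray of direction [Lambda kappa v] the length is [t] and [qden] is [t Q], so the slope is
    constant along the ray. *)
Lemma slope_Lambda v t : 0 < t -> k * enorm v ^+ 2 <= 1 ->
  slope kappa (t *: (Lambda kappa v).1, t * (Lambda kappa v).2) = v.
Proof.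
move=> t0 kv; rewrite /slope /qden.
have -> : enormX (t *: (Lambda kappa v).1, t * (Lambda kappa v).2) = t.
  apply/eqP; rewrite -(eqrXn2 (n := 2)) ?enormX_ge0 ?ltW//.
  rewrite enormX_sqr /= exprMn !dotZl !dotZr.
  have := Lambda_unit kv; move/(congr1 (fun x => x ^+ 2)).
  rewrite enormX_sqr /= !dotZl !dotZr expr1n => h; apply/eqP.
  by rewrite -[RHS]mulr1 -h; ring.
have := dirQ_gt0 v; rewrite /=; set Q := dirQ _ _ => Q0.
have -> : kappa * t - t * (kappa - Q) = t * Q by ring.
by rewrite !scalerA mulVf ?scale1r// gt_eqF// mulr_gt0.
Qed.

(* The vertical component is the smaller root of a quadratic equation whose
   coefficients depend on the slope only. *)
Lemma slope_inj L L' : enormX L = 1 -> enormX L' = 1 ->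
  1 < kappa * L.2 -> 1 < kappa * L'.2 ->
  slope kappa L = slope kappa L' -> L = L'.
Proof.
move=> L1 L1' m1 m1'; have kp := kappa1.
have := enormX_sqr L; have := enormX_sqr L'; rewrite L1 L1' expr1n.
case: L L' L1 L1' m1 m1' => [l m] [l' m'] /= L1 L1' m1 m1' N' N.
rewrite /slope /qden L1 L1' /= mulr1 => vE.
have Q0 : 0 < kappa - m by have := dot_ge0 l; nra.
have Q0' : 0 < kappa - m' by have := dot_ge0 l'; nra.
have mE : m = m'.
  have E : (kappa - m) ^-2 * dot l l = (kappa - m') ^-2 * dot l' l'.
    have := congr1 (fun x => dot x x) vE.
    by rewrite /= !dotZl !dotZr !mulrA -!expr2 !exprVn.
  have : (kappa - m') ^+ 2 * (1 - m ^+ 2) = (kappa - m) ^+ 2 * (1 - m' ^+ 2).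
        have -> : 1 - m ^+ 2 = dot l l by lra.
    have -> : 1 - m' ^+ 2 = dot l' l' by lra.
    have -> : dot l l = (kappa - m) ^+ 2 * ((kappa - m') ^-2 * dot l' l').
      by rewrite -E mulrA divff ?mul1r// expf_neq0// gt_eqF.
    by move: (dot l' l') => d; field; rewrite gt_eqF.
  move=> E2; apply/eqP; rewrite -subr_eq0; apply/negPn/negP => mm.
  (* The second factor is positive, since [kappa m > 1] and [m < kappa], and likewise for [m']. *)
  have : (m - m') * ((kappa * m - 1) * (kappa - m') + (kappa * m' - 1) * (kappa - m)) = 0.
    by lra.
  move/eqP; rewrite mulf_eq0 (negbTE mm)/= gt_eqF//.
  by rewrite addr_gt0// mulr_gt0// subr_gt0.
subst m'; congr pair; move: vE => /(congr1 (fun x => (kappa - m) *: x)).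
by rewrite !scalerA divff ?gt_eqF// !scale1r.
Qed.

End direction.

(** * Regularity as concavity *)

Section hyperboloids_through_a_point.
Context {R : realType} {n : nat}.
Variables (kappa T0 Rm b0 : R).
Hypotheses (kappa1 : 1 < kappa) (T0_gt0 : 0 < T0) (Rm_gt0 : 0 < Rm)
  (b0_gt0 : 0 < b0).
Implicit Types (v w : 'rV[R]_n) (V X Y Z : ambient R n) (t h : R).

Local Notation k := (kappa ^+ 2 - 1).
Local Notation q0 := ((kappa - 1) * T0).
Local Notation qden := (qden kappa).
Local Notation slope := (slope kappa).
Local Notation excess := (excess kappa).
Local Notation lcone := (lcone kappa).
Local Notation admissible := (admissible kappa T0 Rm b0).

Lemma cost_admissible Z Y : admissible (Y - Z) -> 0 < cost kappa Z Y.
Proof.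
by move=> [_ _ /= h]; rewrite /cost enormXB; exact: lt_le_trans b0_gt0 h.
Qed.

Lemma phi_excess_le Z Y w h : admissible (Y - Z) ->
  0 <= excess (Y - Z) w h -> phi kappa (Z.1 + w) Y Z <= Z.2 + h.
Proof.
move=> aV ex; rewrite /phi hyperboloid_le ?(ltW (cost_admissible aV))//.
by apply: excess_cost_le => //; apply: (qden_gt0 kappa1 T0_gt0 aV).
Qed.

Lemma phi_excess_ge Z Y w h : admissible (Y - Z) ->
  kappa * h <= enormX (Y - Z) ->
  excess (Y - Z) w h < 0 -> Z.2 + h <= phi kappa (Z.1 + w) Y Z.
Proof.
move=> aV kh; apply: contra_ltT; rewrite -ltNge => /ltW.
rewrite /phi hyperboloid_le ?(ltW (cost_admissible aV))//.
by apply: cost_le_excess => //; apply: (qden_gt0 kappa1 T0_gt0 aV).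
Qed.

Lemma phi_base Z Y : admissible (Y - Z) -> phi kappa Z.1 Y Z = Z.2.
Proof.
move=> aV; apply: hyperboloid_uniq; [by []|exact/ltW/cost_admissible|by case: Z {aV}].
Qed.

Lemma dot_slope_sqr_le V w : admissible V ->
  k * dot (slope V) w ^+ 2 <= enorm w ^+ 2.
Proof.
move=> aV; have k0 := kappa_sqr1 kappa1.
have h1 := slope_sqr_lt1 kappa1 T0_gt0 b0_gt0 aV.
have := ler_wpM2l (ltW k0) (dot_sqr_le (slope V) w).
rewrite -!enorm_sqr => h2; apply: le_trans h2 _.
have := ler_wpM2r (sqr_ge0 (enorm w)) (ltW h1).
by rewrite mul1r -mulrA.
Qed.

(** Near its base point the hyperboloid is squeezed between the plane [v.w], where the excess is
    nonnegative, and the paraboloid [v.w - |w|^2 / q0], where it is negative for [w] different from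
    0. *)
Lemma grad_phi Z Y : admissible (Y - Z) ->
  grad (fun x => phi kappa x Y Z) Z.1 = slope (Y - Z).
Proof.
move=> aV; have q0p : 0 < q0 := qmin_gt0 kappa1 T0_gt0.
have qV := qden_gt0 kappa1 T0_gt0 aV.
have k0 := kappa_sqr1 kappa1.
have kp : 0 < kappa by rewrite (lt_trans ltr01).
apply: (proj2 (@expansion_grad R n _ _ _ _)) => e e0; set v := slope _.
have D0 : 0 < kappa * (enorm v + 1).
  by rewrite mulr_gt0// ltr_wpDl ?enorm_ge0.
(* The first radius makes [|w|^2 / q0 <= e |w|]; the second provides the bound on [kappa h] that
   [phi_excess_ge] requires. *)
exists (Num.min (e * q0) (T0 / (kappa * (enorm v + 1)))).
  by rewrite lt_min mulr_gt0//= divr_gt0.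
move=> w; rewrite lt_min => /andP[we wT].
rewrite /= (phi_base aV).
have w0 := enorm_ge0 w.
have vw := dot_le v w.
have upper : phi kappa (Z.1 + w) Y Z <= Z.2 + dot v w.
  apply: phi_excess_le => //; rewrite /excess subrr add0r /lcone.
  rewrite divr_ge0 ?mulr_ge0 ?(ltW qV)// subr_ge0 -enorm_sqr.
  exact: dot_slope_sqr_le.
have [w00|wn0] := eqVneq (enorm w) 0.
  rewrite (enorm_eq0 w00) addr0 (phi_base aV) subrr sub0r -(scale0r 0) dotZr.
  by rewrite mul0r oppr0 normr0 mulr_ge0 ?enorm_ge0// ltW.
have wp : 0 < enorm w by rewrite lt_def wn0.
have lower : Z.2 + (dot v w - enorm w ^+ 2 / q0) <= phi kappa (Z.1 + w) Y Z.
  apply: phi_excess_ge => //.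
    have [TV _ _] := aV.
    apply: (@le_trans _ _ T0); last first.
      apply: le_trans TV _; apply: le_trans (ler_norm _) _.
      exact: snd_le_enormX.
    have h1 : enorm w * (kappa * (enorm v + 1)) < T0 by rewrite -ltr_pdivlMr.
    have h2 : 0 <= enorm w ^+ 2 / q0 by rewrite divr_ge0 ?sqr_ge0 ?(ltW q0p).
    have h3 := le_trans (ler_norm _) vw.
    have h4 : kappa * (dot v w - enorm w ^+ 2 / q0) <= kappa * (enorm v * enorm w).
      by rewrite ler_pM2l//; lra.
    have h5 : 0 <= kappa * enorm w by rewrite mulr_ge0// ltW.
    by lra.
  apply: le_lt_trans (excess_le kappa1 T0_gt0 w _ aV) _; rewrite -/v.
  have -> : dot v w - enorm w ^+ 2 / q0 - dot v w + enorm w ^+ 2 / (2 * q0) =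
    - (enorm w ^+ 2 / (2 * q0)).
    by field; rewrite gt_eqF// subr_eq0 gt_eqF.
  by rewrite oppr_lt0 divr_gt0 ?exprn_gt0// mulr_gt0.
have we2 : enorm w ^+ 2 / q0 <= e * enorm w.
  by rewrite ler_pdivrMr// expr2 mulrAC ler_pM2r// ltW.
have ew : 0 <= e * enorm w by rewrite mulr_ge0// ltW.
rewrite ler_norml; apply/andP; split; lra.
Qed.

Lemma near_right_small (a b c : R) : 0 < c ->
  \forall t \near 0^'+, `|a * t + b * t ^+ 2| < c.
Proof.
move=> c0; pose B := `|a| + `|b| + 1.
have B0 : 0 < B by rewrite ltr_wpDl.
near=> t.
have t0 : 0 < t by [].
have t1 : t < 1 by near: t; exact: nbhs_right_lt.
have tB : t < c / B by near: t; apply: nbhs_right_lt; rewrite divr_gt0.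
move: tB; rewrite ltr_pdivlMr// => tB.
apply: le_lt_trans tB; apply: le_trans (ler_normD _ _) _.
rewrite (normrM a) (normrM b) normrX (gtr0_norm t0).
have h1 : `|b| * t ^+ 2 <= `|b| * t.
  by rewrite ler_wpM2l// expr2 ler_piMr// ltW.
rewrite /B; lra.
Unshelve. all: by end_near. Qed.

Lemma orthogonal_unit (e : 'rV[R]_n) : (2 <= n)%N ->
  exists2 w, enorm w = 1 & dot e w = 0.
Proof.
move=> n2; pose i0 := Ordinal (ltnW n2); pose i1 := Ordinal n2.
have dotd x (i : 'I_n) : dot x (delta_mx 0 i) = x 0 i.
  rewrite /dot (bigD1 i)//= big1 => [|j ji]; rewrite !mxE ?eqxx ?mulr1 ?addr0//.
  by rewrite (negbTE ji) mulr0.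
suff [w w0 ew] : exists2 w, w != 0 & dot e w = 0.
  have wp : 0 < enorm w.
    by rewrite lt_def enorm_ge0 andbT; apply: contra_neq w0; exact: enorm_eq0.
  exists ((enorm w)^-1 *: w); last by rewrite dotZr ew mulr0.
  by rewrite enormZ gtr0_norm ?invr_gt0// mulVf// gt_eqF.
have [e0|e0] := eqVneq (e 0 i0) 0.
  exists (delta_mx 0 i0); last by rewrite dotd.
  apply/eqP => /rowP/(_ i0); rewrite !mxE !eqxx; exact/eqP/oner_neq0.
exists (e 0 i1 *: delta_mx 0 i0 - e 0 i0 *: delta_mx 0 i1).
  apply/eqP => /rowP/(_ i1); rewrite !mxE /= mulr0 sub0r mulr1.
  by move/eqP; rewrite oppr_eq0 (negbTE e0).
by rewrite dotBr !dotZr !dotd mulrC subrr.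
Qed.

(* Along w t + tau e t^2, the second-order term of phi is
   [tau s.e - theta (1 - k (s.w)^2)]; the shift tau makes the two outer ones
   equal, so that the maximum becomes their convex combination. *)
Lemma theta_concave Z Y0 Y1 Yl (l A r : R) : (2 <= n)%N ->
  admissible (Y0 - Z) -> admissible (Y1 - Z) -> admissible (Yl - Z) ->
  slope (Yl - Z) = (1 - l) *: slope (Y0 - Z) + l *: slope (Y1 - Z) ->
  slope (Y0 - Z) <> slope (Y1 - Z) -> 0 < A -> 0 < r ->
  (forall w, enorm w < r -> phi kappa (Z.1 + w) Yl Z <=
     Num.max (phi kappa (Z.1 + w) Y0 Z) (phi kappa (Z.1 + w) Y1 Z)
       - A * enorm w ^+ 2) ->
  (1 - l) / (2 * qden (Y0 - Z)) + l / (2 * qden (Y1 - Z)) + A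
    <= (2 * qden (Yl - Z))^-1.
Proof.
move=> n2 a0 a1 al slE s01 A0 r0 reg.
have k0 := kappa_sqr1 kappa1.
pose e := slope (Y1 - Z) - slope (Y0 - Z).
pose E := dot e e.
have E0 : 0 < E.
  rewrite lt_def dot_ge0 andbT; apply/eqP => /dot_eq0/eqP.
  by rewrite subr_eq0 => /eqP/esym.
have [w w1 ew] := orthogonal_unit e n2.
pose p := dot (slope (Y0 - Z)) w.
have p1 : dot (slope (Y1 - Z)) w = p.
  by move: ew; rewrite /e dotBl => /eqP; rewrite subr_eq0 => /eqP.
have pl : dot (slope (Yl - Z)) w = p by rewrite slE dotDl (dotZl (1 - l)) (dotZl l) p1 -/p; ring.
pose P0 := 1 - k * p ^+ 2.
have P0_ge0 : 0 <= P0.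
  by have := dot_slope_sqr_le w a0; rewrite w1 expr1n subr_ge0.
have P0_le1 : P0 <= 1 by rewrite gerBl mulr_ge0 ?sqr_ge0// ltW.
pose th V := (2 * qden V)^-1.
pose tau := (th (Y1 - Z) - th (Y0 - Z)) * P0 / E.
have tauE : tau * E = (th (Y1 - Z) - th (Y0 - Z)) * P0.
  by rewrite divfK// gt_eqF.
pose sig V := tau * dot (slope V) e - th V * P0.
pose wt t := t *: w + (t ^+ 2 * tau) *: e.
have wt2 t : dot (wt t) (wt t) = t ^+ 2 + t ^+ 4 * tau ^+ 2 * E.
  rewrite /wt !dotDl !dotDr !dotZl !dotZr -enorm_sqr w1 expr1n ew (dotC w) ew.
  by rewrite -/E; ring.
(* [sig V] is thus the coefficient of [t^2] in the hyperboloid along the curve: for small [t] the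
   sign of the excess at height [t p + t^2 s] is that of [s - sig V]. *)
have exE V s t : dot (slope V) w = p ->
    excess V (wt t) (t * p + t ^+ 2 * s) = t ^+ 2 * ((s - sig V) +
      ((- 2 * th V * k * p * s) * t + (th V * (tau ^+ 2 * E - k * s ^+ 2)) * t ^+ 2)).
  move=> Vp; rewrite /excess /lcone wt2 /wt !dotDr !dotZr Vp -/(th V) /sig /P0.
  by ring.
have sig01 : sig (Y1 - Z) = sig (Y0 - Z).
  have : tau * (dot (slope (Y1 - Z)) e - dot (slope (Y0 - Z)) e) =
    (th (Y1 - Z) - th (Y0 - Z)) * P0 by rewrite -dotBl.
  by rewrite /sig; lra.
set sg := sig (Y0 - Z) in sig01.
have sigl : sig (Yl - Z) = sg +
    ((1 - l) * th (Y0 - Z) + l * th (Y1 - Z) - th (Yl - Z)) * P0.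
  have -> : sg = (1 - l) * sig (Y0 - Z) + l * sig (Y1 - Z).
    by rewrite sig01 -/sg; ring.
  by rewrite /sig slE dotDl (dotZl (1 - l)) (dotZl l); ring.
(* This bounds the gain in theta times [P0] from below by [A]; as [0 <= P0 <= 1], the gain itself is
   at least [A]. *)
suff sA : sig (Yl - Z) <= sg - A.
  move: sA; rewrite sigl -/(th (Yl - Z)).
  set D := th (Yl - Z); set C := _ + l * _ => sA.
  have h : A <= (D - C) * P0 by lra.
  have DC : 0 < D - C.
    rewrite ltNge; apply/negP => h1; have := mulr_le0_ge0 h1 P0_ge0; lra.
  have : (D - C) * P0 <= D - C by rewrite ler_piMr// ltW.
  by rewrite /C /D /th in h *; lra.
rewrite leNgt; apply/negP => lt.
(* Each of the two one-sided expansions loses [eps], together two thirds of the defect, so the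
   remaining third gives the contradiction. *)
pose eps := (sig (Yl - Z) - (sg - A)) / 3.
have eps0 : 0 < eps by rewrite divr_gt0// subr_gt0.
have : \forall t \near (0 : R)^'+, False; last by move=> /filter_ex[].
near=> t.
have t0 : 0 < t by [].
have tt0 : 0 < t ^+ 2 by rewrite exprn_gt0.
have wtr : enorm (wt t) < r.
  apply: le_lt_trans (enormD _ _) _; rewrite !enormZ w1 mulr1.
  rewrite (normrM _ tau) normrX (gtr0_norm t0).
  have : `|1 * t + (`|tau| * enorm e) * t ^+ 2| < r.
    by near: t; exact: near_right_small.
  by move/(le_lt_trans (ler_norm _)); lra.
have kh : kappa * (t * p + t ^+ 2 * (sig (Yl - Z) - eps)) <= enormX (Yl - Z).
  have [TV _ _] := al; apply: (@le_trans _ _ T0); last first.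
    by apply: le_trans TV _; apply: le_trans (ler_norm _) (snd_le_enormX _).
  have : `|(kappa * p) * t + (kappa * (sig (Yl - Z) - eps)) * t ^+ 2| < T0.
    by near: t; exact: near_right_small.
  by move/(le_lt_trans (ler_norm _)) => h; lra.
have up V : dot (slope V) w = p -> sig V = sg ->
    `|(- 2 * th V * k * p * (sg + eps)) * t +
      (th V * (tau ^+ 2 * E - k * (sg + eps) ^+ 2)) * t ^+ 2| < eps ->
    0 <= excess V (wt t) (t * p + t ^+ 2 * (sg + eps)).
  move=> Vp sV; rewrite exE// sV ltr_norml => /andP[h _].
  by rewrite mulr_ge0// ?(ltW tt0)//; clear -h; lra.
have u0 : phi kappa (Z.1 + wt t) Y0 Z <= Z.2 + (t * p + t ^+ 2 * (sg + eps)).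
  apply: phi_excess_le => //; apply: up => //.
  by near: t; exact: near_right_small.
have u1 : phi kappa (Z.1 + wt t) Y1 Z <= Z.2 + (t * p + t ^+ 2 * (sg + eps)).
  apply: phi_excess_le => //; apply: up => //.
  by near: t; exact: near_right_small.
have lo : Z.2 + (t * p + t ^+ 2 * (sig (Yl - Z) - eps)) <= phi kappa (Z.1 + wt t) Yl Z.
  apply: phi_excess_ge => //; rewrite exE// pmulr_rlt0//.
  have : `|(- 2 * th (Yl - Z) * k * p * (sig (Yl - Z) - eps)) * t +
    (th (Yl - Z) * (tau ^+ 2 * E - k * (sig (Yl - Z) - eps) ^+ 2)) * t ^+ 2| < eps.
    by near: t; exact: near_right_small.
  by rewrite ltr_norml => /andP[_ h]; clear -h; lra.
have := le_trans lo (reg _ wtr).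
have mx : Num.max (phi kappa (Z.1 + wt t) Y0 Z) (phi kappa (Z.1 + wt t) Y1 Z) <=
   Z.2 + (t * p + t ^+ 2 * (sg + eps)) by rewrite ge_max u0 u1.
have wtt : A * t ^+ 2 <= A * enorm (wt t) ^+ 2.
  rewrite ler_pM2l// enorm_sqr wt2 lerDl mulr_ge0 ?(ltW E0)//.
  by rewrite mulr_ge0 ?sqr_ge0// exprn_ge0// ltW.
move=> h; have : t ^+ 2 * (sig (Yl - Z) - (sg - A) - 2 * eps) <= 0 by clear -h mx wtt; lra.
rewrite pmulr_rle0//; have : sig (Yl - Z) - (sg - A) = 3 * eps.
  by rewrite /eps; field.
clear -eps0; lra.
Unshelve. all: by end_near. Qed.

End hyperboloids_through_a_point.

(** * The source and the target *)

Section setting_facts.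
Context {R : realType} {n : nat}.
Variables (kappa tau0 tau1 omega : R) (Omega : set 'rV[R]_n)
  (Sigma : set (ambient R n)) (s : ambient R n -> ambient R n -> R).
Hypothesis hs : setting kappa tau0 tau1 omega Omega Sigma s.
Implicit Types (x : 'rV[R]_n) (X Y Z : ambient R n).

Lemma bounded_enorm (A : set 'rV[R]_n) : bounded_set A ->
  exists2 B : R, 0 < B & forall x, A x -> enorm x <= B.
Proof.
move=> /ex_strict_bound_gt0[B B0 AB].
exists (Num.sqrt n%:R * B + 1); first by rewrite ltr_wpDl// mulr_ge0 ?sqrtr_ge0 ?ltW.
move=> x /AB /ltW xB; apply: le_trans (enorm_le_norm x) _.
by apply: ler_wpDr => //; rewrite ler_wpM2l ?sqrtr_ge0.
Qed.

Lemma source_diameter : exists2 W : R, 0 < W &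
  forall x x', Omega x -> Omega x' -> enorm (x - x') <= W.
Proof.
have [B B0 OB] := bounded_enorm (source_bounded hs).
exists (B + B) => [|x x' /OB xB /OB xB']; first exact: addr_gt0.
by apply: le_trans (enormD _ _) _; rewrite enormN lerD.
Qed.

Lemma target_bounded : exists2 B : R, 0 < B &
  forall Y, Sigma Y -> enorm Y.1 <= B.
Proof.
have cf : compact (fst @` Sigma).
  apply: continuous_compact (target_compact hs).
  by apply: continuous_subspaceT => X; exact: cvg_fst.
have [B B0 SB] := bounded_enorm (compact_bounded cf).
by exists B => // Y SY; apply: SB; exists Y.
Qed.

Lemma dist_le_Delta x Y : Omega x -> Sigma Y -> enorm (x - Y.1) <= Delta Omega Sigma.
Proof.
have [B B0 OB] := bounded_enorm (source_bounded hs).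
have [B' B0' SB] := target_bounded.
pose S Y' := [set d | exists a b, [/\ (Omega `|` [set Y'.1]) a,
  (Omega `|` [set Y'.1]) b & d = enorm (a - b)]] : set R.
(* A supremum dominates its set only when an upper bound exists; one bound serves for every target
   point, hence for both suprema. *)
have SD Y' : Sigma Y' -> ubound (S Y') (2 * (B + B')).
  move=> SY' _ [a [b [Aa Ab ->]]].
  have BA a' : (Omega `|` [set Y'.1]) a' -> enorm a' <= B + B'.
    by move=> [/OB|->]; [|move: (SB _ SY')]; lra.
  have := enormD a (- b); rewrite enormN.
  by have := BA _ Aa; have := BA _ Ab; lra.
move=> Ox SY.
apply: (@le_trans _ _ (ediam (Omega `|` [set Y.1]))).
  apply: ub_le_sup; first by exists (2 * (B + B')); exact: SD.
  by exists x, Y.1; split=> //; [left|right].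
apply: ub_le_sup; last by exists Y.
exists (2 * (B + B')) => _ [Y' SY' <-]; apply: ge_sup; last exact: SD.
by exists (enorm (x - x)); exists x, x; split => //; left.
Qed.

(** The vertical distance [T] is at least [tau1 - tau0], and [tau1_ge] bounds the horizontal
    distance by [(tau1 - tau0) (kappa - 1) / kappa]. The cost is at least [(kappa - 1) T] minus the
    horizontal distance, which leaves [(tau1 - tau0) (kappa - 1)^2 / kappa]. *)
Lemma admissible_setting : exists T0 Rm b0 : R, [/\ 0 < T0, 0 < Rm, 0 < b0 &
  forall X Y, cylinder Omega tau0 X -> Sigma Y ->
    admissible kappa T0 Rm b0 (Y - X)].
Proof.
have k1 := kappa_gt1 hs; have t01 := tau0_lt_tau1 hs; have t0 := tau0_gt0 hs.
have o0 := omega_gt0 hs.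
have kp : 0 < kappa by rewrite (lt_trans ltr01).
have b0 : 0 < (kappa - 1) ^+ 2 / kappa.
  by rewrite divr_gt0// exprn_gt0// subr_gt0.
exists (tau1 - tau0), (tau1 + omega + `|Delta Omega Sigma|),
  ((tau1 - tau0) * ((kappa - 1) ^+ 2 / kappa)); split.
- by rewrite subr_gt0.
- have := normr_ge0 (Delta Omega Sigma); lra.
- by rewrite mulr_gt0// subr_gt0.
move=> X Y [OX /andP[X0 Xt]] SY.
have /andP[Y1 Y2] := target_strip hs SY.
have VD := dist_le_Delta OX SY; rewrite enormB in VD.
have D0 := le_trans (enorm_ge0 _) VD.
set D := Delta Omega Sigma in VD D0 *.
have := enormX_le (Y - X); rewrite /= gtr0_norm; last by lra.
set T := Y.2 - X.2; set d := enorm _ in VD *; set N := enormX _ => NE.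
have TT : tau1 - tau0 <= T by rewrite /T; lra.
have DT : kappa * D <= (tau1 - tau0) * (kappa - 1).
  have : tau0 + kappa * D / (kappa - 1) <= tau1.
    by apply: le_trans (tau1_ge hs); rewrite le_max lexx orbT.
  by rewrite addrC -lerBrDr ler_pdivrMr ?subr_gt0.
split => //=.
  have T1 : T <= tau1 + omega by rewrite /T; lra.
  by rewrite (ger0_norm D0) -/N; lra.
rewrite -(ler_pM2l kp) -/N -/T.
have -> : kappa * ((tau1 - tau0) * ((kappa - 1) ^+ 2 / kappa)) =
  (tau1 - tau0) * (kappa - 1) ^+ 2 by field; rewrite gt_eqF.
have h1 : kappa * N <= kappa * (d + T) by rewrite ler_pM2l.
have h2 : kappa * d <= kappa * D by rewrite ler_pM2l.
have h3 : (tau1 - tau0) * (kappa - 1) <= T * (kappa - 1).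
  by rewrite ler_pM2r// subr_gt0.
have h4 : (tau1 - tau0) * (kappa - 1) * (kappa - 1) <= T * (kappa - 1) * (kappa - 1).
  by rewrite ler_pM2r// subr_gt0.
rewrite expr2; nra.
Qed.

(** Since [kappa * tau0 <= tau1], points of height at most [tau0] are on the sheet for which
    [cost_le_excess] applies. *)
Lemma height_le Z Y (h : R) : cylinder Omega tau0 Z -> Sigma Y ->
  Z.2 + h <= tau0 -> kappa * h <= enormX (Y - Z).
Proof.
move=> [_ /andP[Z0 _]] SY h0; have k1 := kappa_gt1 hs.
have /andP[Y1 _] := target_strip hs SY.
have t1 : kappa * tau0 <= tau1.
  by apply: le_trans (tau1_ge hs); rewrite le_max lexx.
apply: le_trans (le_trans (ler_norm _) (snd_le_enormX _)).
rewrite /=.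
have h1 : kappa * (Z.2 + h) <= kappa * tau0 by rewrite ler_pM2l// (lt_trans ltr01).
have h2 : Z.2 <= kappa * Z.2 by rewrite ler_peMl// ltW.
lra.
Qed.

Section with_bounds.
Variables T0 Rm b0 : R.
Hypotheses (T0_gt0 : 0 < T0) (Rm_gt0 : 0 < Rm) (b0_gt0 : 0 < b0).
Hypothesis adm : forall X Y, cylinder Omega tau0 X -> Sigma Y ->
  admissible kappa T0 Rm b0 (Y - X).

(** Positivity of the cost gives [kappa L.2 > 1] for the unit direction [L] of [Y] from [Z], so the
    slope determines [L]; the parametrization of the target then determines the point. *)
Lemma slope_target_inj Z Y Y' : cylinder Omega tau0 Z -> Sigma Y -> Sigma Y' ->
  slope kappa (Y - Z) = slope kappa (Y' - Z) -> Y = Y'.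
Proof.
move=> cZ SY SY' sE; have k1 := kappa_gt1 hs.
have dir Y1 : Sigma Y1 -> exists L, [/\ enormX L = 1, 0 < s Z L,
    Y1 = ray Z (s Z L) L, 1 < kappa * L.2 &
    slope kappa L = slope kappa (Y1 - Z)].
  move=> SY1; have [L [L1 s0 YE]] := target_param hs cZ SY1.
  exists L; have VE : Y1 - Z = (s Z L *: L.1, s Z L * L.2) :> ambient R n.
    by rewrite YE /ray; congr pair; rewrite /= addrC addKr.
  have VN : enormX ((s Z L *: L.1, s Z L * L.2) : ambient R n) = s Z L.
    apply/eqP; rewrite -(eqrXn2 (n := 2)) ?enormX_ge0 ?ltW//.
    rewrite enormX_sqr /= exprMn !dotZl !dotZr.
    have := enormX_sqr L; rewrite L1 expr1n => h; apply/eqP.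
    by rewrite -[RHS]mulr1 h; ring.
  split => //.
    have [_ _] := adm cZ SY1; rewrite VE VN /= => h.
    have : 0 < s Z L * (kappa * L.2 - 1).
      by rewrite mulrBr mulr1 mulrCA; exact: lt_le_trans b0_gt0 h.
    by rewrite pmulr_rgt0// subr_gt0.
  rewrite VE /slope /qden VN L1 /= scalerA mulr1.
  congr (_ *: _); rewrite -[_ * s Z L](mulrC (s Z L)) -mulrBr invfM mulrAC mulVf.
    by rewrite mul1r.
  by rewrite gt_eqF.
have [L [L1 s0 YE m1 LE]] := dir _ SY; have [L' [L1' s0' YE' m1' LE']] := dir _ SY'.
have LL : L = L' by apply: (slope_inj k1) => //; rewrite LE LE'.
by rewrite YE YE' LL.
Qed.

Lemma grad_phi_target Z Y : cylinder Omega tau0 Z -> Sigma Y ->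
  grad (fun x => phi kappa x Y Z) Z.1 = slope kappa (Y - Z).
Proof.
move=> cZ SY; apply: (grad_phi (kappa_gt1 hs) T0_gt0 b0_gt0); exact: adm.
Qed.

Lemma slope_Ypath Z Y0 Y1 (l : R) : cylinder Omega tau0 Z -> Sigma Y0 -> Sigma Y1 ->
  0 <= l <= 1 ->
  slope kappa (Ypath kappa s Y0 Y1 Z l - Z) =
    (1 - l) *: slope kappa (Y0 - Z) + l *: slope kappa (Y1 - Z).
Proof.
move=> cZ S0 S1 /andP[l0 l1]; have k1 := kappa_gt1 hs.
have kp := kappa_sqr1 k1.
have [t0 _] := param_path hs S0 S1 cZ (introT andP (conj l0 l1)).
have vE : vpath kappa Y0 Y1 Z l =
    (1 - l) *: slope kappa (Y0 - Z) + l *: slope kappa (Y1 - Z).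
  by rewrite /vpath !grad_phi_target.
rewrite -vE; set v := vpath kappa _ _ _ _.
(* By convexity of the norm, slopes on the segment stay in the ball where [Lambda] has unit
   values. *)
have vN : (kappa ^+ 2 - 1) * enorm v ^+ 2 <= 1.
  have sN Y : Sigma Y -> Num.sqrt (kappa ^+ 2 - 1) * enorm (slope kappa (Y - Z)) <= 1.
    move=> SY; have := slope_sqr_lt1 k1 T0_gt0 b0_gt0 (adm cZ SY).
    rewrite -{1}(sqr_sqrtr (ltW kp)) -exprMn => h.
    rewrite -(@ler_pXn2r _ 2) ?nnegrE ?mulr_ge0 ?sqrtr_ge0 ?enorm_ge0//.
    by rewrite expr1n ltW.
  rewrite -{1}(sqr_sqrtr (ltW kp)) -exprMn.
  rewrite -[leRHS](expr1n _ 2) lerXn2r ?nnegrE ?mulr_ge0 ?sqrtr_ge0 ?enorm_ge0//.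
  rewrite /v vE.
  have h : enorm ((1 - l) *: slope kappa (Y0 - Z) + l *: slope kappa (Y1 - Z)) <=
     (1 - l) * enorm (slope kappa (Y0 - Z)) + l * enorm (slope kappa (Y1 - Z)).
    apply: le_trans (enormD _ _) _; rewrite !enormZ (ger0_norm l0) ger0_norm//.
    by rewrite subr_ge0.
  apply: le_trans (ler_wpM2l (sqrtr_ge0 _) h) _.
  have l1' : 0 <= 1 - l by rewrite subr_ge0.
  have := ler_wpM2l l1' (sN _ S0); have := ler_wpM2l l0 (sN _ S1); lra.
have -> : Ypath kappa s Y0 Y1 Z l - Z =
  (s Z (Lambda kappa v) *: (Lambda kappa v).1,
   s Z (Lambda kappa v) * (Lambda kappa v).2) :> ambient R n.
  by rewrite /Ypath /ray -/v; congr pair; rewrite /= addrC addKr.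
exact: slope_Lambda.
Qed.

End with_bounds.
End setting_facts.

(** * Refractors *)

Section refractor.
Context {R : realType} {n : nat}.
Variables (kappa tau0 tau1 omega : R) (Omega : set 'rV[R]_n)
  (Sigma : set (ambient R n)) (s : ambient R n -> ambient R n -> R).
Hypothesis hs : setting kappa tau0 tau1 omega Omega Sigma s.
Variables T0 Rm b0 W L0 : R.
Hypotheses (T0_gt0 : 0 < T0) (Rm_gt0 : 0 < Rm) (b0_gt0 : 0 < b0) (W_gt0 : 0 < W)
  (L0_gt0 : 0 < L0).
Hypothesis adm : forall X Y, cylinder Omega tau0 X -> Sigma Y ->
  admissible kappa T0 Rm b0 (Y - X).
Hypothesis diam : forall x x', Omega x -> Omega x' -> enorm (x - x') <= W.
Hypothesis kL0 : (kappa ^+ 2 - 1) * L0 ^+ 2 < 1.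
Hypothesis slopeL0 : forall (V : ambient R n) w (h : R),
  admissible kappa T0 Rm b0 V -> enorm w <= W ->
  h <= 0 -> 0 <= excess kappa V w h -> - h <= L0 * enorm w.
Variable u : 'rV[R]_n -> R.
Hypothesis hu : parallel_refractor kappa tau0 Omega Sigma u.
Implicit Types (x w : 'rV[R]_n) (X Y Z V : ambient R n).

Local Notation k := (kappa ^+ 2 - 1).
Local Notation q0 := ((kappa - 1) * T0).
Local Notation cyl := (cylinder Omega tau0).
Local Notation F := (refractor_map kappa Omega Sigma u).
Local Notation slope := (slope kappa).
Local Notation excess := (excess kappa).
Local Notation cost := (cost kappa).
Local Notation slip := (slope_lip kappa T0).
Local Notation tlip := (theta_lip kappa T0).

Let kappa1 : 1 < kappa := kappa_gt1 hs.
Let k_gt0 : 0 < k := kappa_sqr1 kappa1.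
Let q0_gt0 : 0 < q0 := qmin_gt0 kappa1 T0_gt0.

Lemma graph_cyl x : Omega x -> cyl (x, u x).
Proof. by move=> Ox; split => //=; have /andP[/ltW -> ->] := hu.1 x Ox. Qed.

(** Being above a hyperboloid is being in a sublevel set of the cost, so contact points are maximum
    points of the cost along the graph. Existence of contacts thereby becomes a compactness
    argument. *)
Lemma refractor_mapE x Y : Omega x ->
  F x Y <-> Sigma Y /\ forall x', Omega x' -> cost (x', u x') Y <= cost (x, u x) Y.
Proof.
move=> Ox; split=> -[SY h]; split=> // x' Ox'; move: (h x' Ox');
  rewrite /phi hyperboloid_le// ltW//;
  exact: (cost_admissible b0_gt0 (adm (graph_cyl Ox) SY)).
Qed.

Lemma refractor_map_target x Y : F x Y -> Sigma Y.
Proof. by case. Qed.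

Lemma refractor_map_neq0 x : Omega x -> exists Y, F x Y.
Proof.
move=> Ox; have [Y [b [SY /andP[b1 _] hle hx]]] := hu.2 x Ox.
exists Y; split => // x' Ox'.
by rewrite /phi hx cost_hyperboloid ?(ltW b1)//; exact: hle.
Qed.

Lemma graphE Z x : (x, u x) = (Z.1 + (x - Z.1), Z.2 + (u x - Z.2)).
Proof. by rewrite ![_ + (_ - _)]addrC !subrK. Qed.

Lemma target_excess Z Y x : cyl Z -> Sigma Y -> Omega x ->
  cost (x, u x) Y <= cost Z Y -> 0 <= excess (Y - Z) (x - Z.1) (u x - Z.2).
Proof.
move=> cZ SY Ox; rewrite (graphE Z); apply: cost_le_excess.
  by apply: (qden_gt0 kappa1 T0_gt0); exact: adm.
apply: (height_le hs cZ SY); rewrite addrC subrK.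
by have /andP[] := hu.1 x Ox.
Qed.

Lemma refractor_excess x x' Y : Omega x -> Omega x' -> F x Y ->
  0 <= excess (Y - (x, u x)) (x' - x) (u x' - u x).
Proof.
move=> Ox Ox' /(refractor_mapE Y Ox)[SY h].
exact: (@target_excess (x, u x) Y x' (graph_cyl Ox) SY Ox' (h x' Ox')).
Qed.

Lemma excess_lipschitz Z Y w (h : R) : cyl Z -> Sigma Y -> enorm w <= W ->
  0 <= excess (Y - Z) w h -> - h <= L0 * enorm w.
Proof.
move=> cZ SY wW ex; have [h0|h0] := leP h 0.
  by apply: slopeL0 ex => //; exact: adm.
apply: (@le_trans _ _ 0); first by rewrite oppr_le0 ltW.
by rewrite mulr_ge0 ?enorm_ge0// ltW.
Qed.

(** A hyperboloid supporting at one endpoint bounds the descent of [u] from there; exchanging the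
    endpoints gives the other bound. *)
Lemma refractor_lipschitz x x' : Omega x -> Omega x' ->
  `|u x - u x'| <= L0 * enorm (x - x').
Proof.
move=> Ox Ox'.
have half a b : Omega a -> Omega b -> u a - u b <= L0 * enorm (a - b).
  move=> Oa Ob; have [Y Fa] := refractor_map_neq0 Oa.
  have := refractor_excess Oa Ob Fa => /excess_lipschitz.
  rewrite opprB enormB; apply.
  - exact: graph_cyl.
  - exact: refractor_map_target Fa.
  - exact: diam.
by rewrite ler_norml lerNl opprB {1}enormB !half.
Qed.

(** Semiconvexity of [u], with the slope of any supporting hyperboloid as a generalized
    subgradient. *)
Lemma refractor_lower x x' Y : Omega x -> Omega x' -> F x Y ->
  u x + dot (slope (Y - (x, u x))) (x' - x) - enorm (x' - x) ^+ 2 / (2 * q0) <= u x'.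
Proof.
move=> Ox Ox' Fx; have := refractor_excess Ox Ox' Fx.
have aV := adm (graph_cyl Ox) (refractor_map_target Fx).
by move=> /le_trans/(_ (excess_le kappa1 T0_gt0 _ _ aV)); lra.
Qed.

(** * Crossing of two supporting hyperboloids *)

Lemma hyperboloid_continuous Y (b : R) : continuous (hyperboloid kappa Y b).
Proof.
move=> x.
have h0 : y - Y.1 @[y --> x] --> x - Y.1 by exact: (cvgB cvg_id (cvg_cst _)).
have h1 := cvg_comp _ _ h0 (@enorm_continuous R n (x - Y.1)).
have h2 := cvg_comp _ _ h1 (@exprn_continuous R 2 (enorm (x - Y.1))).
have h3 : b ^+ 2 / k ^+ 2 + enorm (y - Y.1) ^+ 2 / k @[y --> x] -->
    b ^+ 2 / k ^+ 2 + enorm (x - Y.1) ^+ 2 / k.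
  exact: (cvgD (cvg_cst _) (cvgMr_tmp (b := k^-1) h2)).
have h4 := cvg_comp _ _ h3 (@sqrt_continuous R _).
exact: (cvgB (cvg_cst _) h4).
Qed.

(* On the segment, the two supporting hyperboloids exchange their order, since
   each lies below u and touches it at its own endpoint. *)
Lemma crossing_point xb xh Yb Yh : Omega xb -> Omega xh -> F xb Yb -> F xh Yh ->
  exists (t : R) (Z : ambient R n), [/\ 0 <= t <= 1, Z.1 = xb + t *: (xh - xb),
    Omega Z.1, cost Z Yb = cost (xb, u xb) Yb /\ cost Z Yh = cost (xh, u xh) Yh &
    Z.2 <= u Z.1 /\ u xb - L0 * enorm (xb - xh) <= Z.2].
Proof.
move=> Ob Oh Fb Fh; have [Sb hb] := Fb; have [Sh hh] := Fh.
pose fb := hyperboloid kappa Yb (cost (xb, u xb) Yb).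
pose fh := hyperboloid kappa Yh (cost (xh, u xh) Yh).
have cb := ltW (cost_admissible b0_gt0 (adm (graph_cyl Ob) Sb)).
have ch := ltW (cost_admissible b0_gt0 (adm (graph_cyl Oh) Sh)).
have fbb : fb xb = u xb by apply: (hyperboloid_uniq kappa1 cb).
have fhh : fh xh = u xh by apply: (hyperboloid_uniq kappa1 ch).
pose pt (t : R) := xb + t *: (xh - xb).
pose g t := fb (pt t) - fh (pt t).
have gc : {within `[0, 1], continuous g}.
  apply: (@continuous_subspaceT _ _ _ g) => t.
  have ptc : pt t' @[t' --> t] --> pt t.
    exact: (cvgD (cvg_cst _) (cvgZr_tmp cvg_id)).
  have cb' := cvg_comp _ _ ptc (@hyperboloid_continuous Yb _ (pt t)).
  have ch' := cvg_comp _ _ ptc (@hyperboloid_continuous Yh _ (pt t)).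
  exact: (cvgB (cb' _) (ch' _)).
have g0 : 0 <= g 0.
  by rewrite /g /pt scale0r addr0 fbb subr_ge0; exact: hh.
have g1 : g 1 <= 0.
  have pt1 : pt 1 = xh by rewrite /pt scale1r addrC subrK.
  by rewrite /g pt1 fhh subr_le0; exact: hb.
have [|t t01 gt] := @IVT R g 0 1 0 ler01 gc.
  by rewrite ge_min g1 orbT le_max g0.
move: t01; rewrite /= in_itv /= => t01.
have Opt : Omega (pt t).
  have /andP[t0 t1] := t01.
  have := source_convex hs (Itv01 t0 t1) (mem_set Oh) (mem_set Ob).
  rewrite inE; congr Omega; rewrite /pt /conv /=.
  by rewrite /unstable.onem scalerBl scale1r scalerBr addrCA.
exists t, (pt t, fb (pt t)); split => //=.
  split; first by rewrite cost_hyperboloid.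
  have -> : fb (pt t) = fh (pt t) by apply/eqP; rewrite -subr_eq0; apply/eqP.
  by rewrite cost_hyperboloid.
split; first exact: hb.
(* Only a crossing below the starting height needs an argument: the hyperboloid through [(xb, u xb)]
   itself descends with slope at most [L0]. *)
have [le0|gt0] := leP (fb (pt t) - u xb) 0; last first.
  have : 0 <= L0 * enorm (xb - xh) by rewrite mulr_ge0 ?enorm_ge0// ltW.
  by lra.
have ex : excess (Yb - (xb, u xb)) (pt t - xb) (fb (pt t) - u xb) = 0.
  apply: cost_eq_excess; first by apply: (qden_gt0 kappa1 T0_gt0); exact: adm (graph_cyl Ob) Sb.
  rewrite /= ![_ + (_ - _)]addrC !subrK; exact: cost_hyperboloid.
have := slopeL0 (adm (graph_cyl Ob) Sb) (diam Opt Ob) le0.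
rewrite ex => /(_ (lexx _)).
have -> : pt t - xb = t *: (xh - xb) by rewrite /pt addrC addKr.
have /andP[t0 t1] := t01.
rewrite enormZ ger0_norm// (enormB xh) => h.
have : L0 * (t * enorm (xb - xh)) <= L0 * enorm (xb - xh).
  by rewrite ler_pM2l// ler_piMl ?enorm_ge0.
lra.
Qed.

Lemma lcone_le w (h : R) : lcone kappa w h <= enorm w ^+ 2.
Proof. by rewrite /lcone -enorm_sqr gerBl mulr_ge0 ?sqr_ge0// ltW. Qed.

Lemma lcone_ge w (h L : R) : `|h| <= L * enorm w ->
  (1 - k * L ^+ 2) * enorm w ^+ 2 <= lcone kappa w h.
Proof.
move=> hL; rewrite /lcone -enorm_sqr.
have h2 : h ^+ 2 <= (L * enorm w) ^+ 2.
  rewrite -real_normK ?num_real// lerXn2r ?nnegrE//; exact: le_trans hL.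
by have := ler_wpM2l (ltW k_gt0) h2; lra.
Qed.

(** Both points lie on one hyperboloid, so the excess vanishes. The descent bounds taken from either
    endpoint together bound the height difference by [L0] times the distance, which makes [lcone]
    nonnegative. *)
Lemma graph_below_tangent Z Y x : cyl Z -> Sigma Y -> Omega x ->
  cost Z Y = cost (x, u x) Y ->
  u x - Z.2 <= dot (slope (Y - Z)) (x - Z.1).
Proof.
move=> cZ SY Ox cE; have OZ : Omega Z.1 by case: cZ.
have qZ := qden_gt0 kappa1 T0_gt0 (adm cZ SY).
have qx := qden_gt0 kappa1 T0_gt0 (adm (graph_cyl Ox) SY).
have e1 : excess (Y - Z) (x - Z.1) (u x - Z.2) = 0.
  by apply: cost_eq_excess => //; rewrite -graphE cE.
have e2 : excess (Y - (x, u x)) (Z.1 - x) (Z.2 - u x) = 0.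
  apply: cost_eq_excess => //=; rewrite ![_ + (_ - _)]addrC !subrK -cE.
  by case: Z {cZ cE OZ qZ e1}.
have h1 : - (u x - Z.2) <= L0 * enorm (x - Z.1).
  by apply: (excess_lipschitz cZ SY (diam Ox OZ)); rewrite e1.
have h2 : - (Z.2 - u x) <= L0 * enorm (Z.1 - x).
  by apply: (excess_lipschitz (graph_cyl Ox) SY (diam OZ Ox)); rewrite e2.
have hL : `|u x - Z.2| <= L0 * enorm (x - Z.1).
  by rewrite ler_norml lerNl h1/= -opprB (enormB x).
have lc : 0 <= lcone kappa (x - Z.1) (u x - Z.2).
  apply: le_trans (lcone_ge hL); rewrite mulr_ge0 ?sqr_ge0// subr_ge0.
  exact: ltW.
have : 0 <= lcone kappa (x - Z.1) (u x - Z.2) / (2 * qden kappa (Y - Z)).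
  by rewrite divr_ge0// mulr_ge0// ltW.
by move: e1; rewrite /excess; lra.
Qed.

(** The tangents at [Z] bound [u] from above at the two base points, and semiconvexity at [Z.1]
    bounds it from below there. Averaging with weights [1 - t] and [t] cancels the unknown
    subgradient and leaves [t (1 - t)] times the difference of the two slopes, plus a quadratic
    error. *)
Lemma crossing_height xb xh Yb Yh (t : R) Z : Omega xb -> Omega xh ->
  Sigma Yb -> Sigma Yh -> 0 <= t <= 1 -> Z.1 = xb + t *: (xh - xb) -> cyl Z ->
  cost Z Yb = cost (xb, u xb) Yb -> cost Z Yh = cost (xh, u xh) Yh ->
  u Z.1 - Z.2 <= slip * enormX (Yb - Yh) * enorm (xb - xh) +
    enorm (xb - xh) ^+ 2 / q0.
Proof.
move=> Ob Oh Sb Sh /andP[t0 t1] ZE cZ cb ch; have OZ : Omega Z.1 by case: cZ.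
have tb := graph_below_tangent cZ Sb Ob cb.
have th := graph_below_tangent cZ Sh Oh ch.
have [Y0 F0] := refractor_map_neq0 OZ.
have lb := refractor_lower OZ Ob F0; have lh := refractor_lower OZ Oh F0.
set w := xh - xb in ZE.
have wE : enorm w = enorm (xb - xh) by rewrite /w enormB.
have bE : xb - Z.1 = - t *: w by rewrite ZE opprD addNKr scaleNr.
have hE : xh - Z.1 = (1 - t) *: w.
  by rewrite ZE opprD addrA -/w scalerBl scale1r.
rewrite bE in tb lb; rewrite hE in th lh.
rewrite !dotZr !enormZ !exprMn !real_normK ?num_real// -wE in tb th lb lh *.
have sd : dot (slope (Yh - Z) - slope (Yb - Z)) w <= slip * enormX (Yb - Yh) * enorm w.
  apply: le_trans (le_trans (ler_norm _) (dot_le _ _)) _.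
  rewrite ler_wpM2r ?enorm_ge0//.
  have := slope_dist kappa1 T0_gt0 (adm cZ Sh) (adm cZ Sb).
  by rewrite opprB addrA subrK (enormXB Yh).
move: tb th lb lh sd; rewrite dotBl.
set D := slip * _ * _; set a := dot _ w; set b := dot _ w; set c := dot _ w.
have W0 : 0 <= enorm w ^+ 2 / q0 by rewrite divr_ge0 ?sqr_ge0// ltW.
have -> : (- t) ^+ 2 * enorm w ^+ 2 / (2 * q0) = t ^+ 2 * (enorm w ^+ 2 / q0 / 2).
  by rewrite invfM; ring.
have -> : (1 - t) ^+ 2 * enorm w ^+ 2 / (2 * q0) = (1 - t) ^+ 2 * (enorm w ^+ 2 / q0 / 2).
  by rewrite invfM; ring.
move: W0; set Q := enorm w ^+ 2 / q0 => Q0 tb th lb lh sd.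
have D0 : 0 <= D.
  rewrite /D mulr_ge0 ?enorm_ge0// mulr_ge0 ?enormX_ge0// ltW//.
  exact: (slope_lip_gt0 kappa1 T0_gt0).
have t1' : 0 <= 1 - t by rewrite subr_ge0.
have m1 := ler_wpM2l t1' tb; have m2 := ler_wpM2l t0 th.
have m3 := ler_wpM2l t1' lb; have m4 := ler_wpM2l t0 lh.
have tt : 0 <= t * (1 - t) <= 1 by apply/andP; split; nra.
have /andP[tt0 tt1] := tt.
have m5 := ler_wpM2l tt0 sd.
have m6 := ler_wpM2r D0 tt1; have m7 := ler_wpM2r Q0 tt1.
lra.
Qed.

Lemma cost_graph_dist x x' Y : Omega x -> Omega x' ->
  `|cost (x, u x) Y - cost (x', u x') Y| <= ((kappa + 1) * L0 + 1) * enorm (x - x').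
Proof.
move=> Ox Ox'; have uL := refractor_lipschitz Ox Ox'.
have := enormX_dist ((x, u x) - Y) ((x', u x') - Y).
rewrite opprB addrA subrK => h1.
have := enormX_le ((x, u x) - (x', u x') : ambient R n); rewrite /= => h2.
have h3 : kappa * `|u x - u x'| <= kappa * (L0 * enorm (x - x')).
  by rewrite ler_pM2l// (lt_trans ltr01).
have h4 : `|kappa * (u x' - u x)| = kappa * `|u x - u x'|.
  by rewrite normrM gtr0_norm ?(lt_trans ltr01)// distrC.
have -> : cost (x, u x) Y - cost (x', u x') Y = kappa * (u x' - u x) -
    (enormX ((x, u x) - Y) - enormX ((x', u x') - Y)).
  by rewrite /cost /=; ring.
apply: le_trans (ler_normB _ _) _; rewrite h4; lra.
Qed.

Lemma cost_target_dist X Y Y' :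
  `|cost X Y - cost X Y'| <= (kappa + 1) * enormX (Y - Y').
Proof.
have := enormX_dist (X - Y) (X - Y').
have -> : X - Y - (X - Y') = - (Y - Y') by rewrite !opprB addrC addrA subrK.
rewrite enormXN => h1; have h2 := snd_le_enormX (Y - Y'); rewrite /= in h2.
have -> : cost X Y - cost X Y' = kappa * (Y.2 - Y'.2) -
    (enormX (X - Y) - enormX (X - Y')) by rewrite /cost; ring.
apply: le_trans (ler_normB _ _) _.
have kp : 0 < kappa by rewrite (lt_trans ltr01).
by rewrite normrM (gtr0_norm kp) mulrDl mul1r lerD// ler_pM2l.
Qed.

(** * Contact points as maximum points of the cost *)

Lemma lipschitz_within (A : set 'rV[R]_n) (g : 'rV[R]_n -> R) (C : R) : 0 < C ->
  (forall x x', A x -> A x' -> `|g x - g x'| <= C * enorm (x - x')) ->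
  {within A, continuous g}.
Proof.
move=> C0 gL; apply/subspace_continuousP => x Ax.
apply/cvgrPdist_lt => e e0; rewrite near_withinE.
pose B := C * (Num.sqrt n%:R + 1).
have B0 : 0 < B by rewrite mulr_gt0// ltr_wpDl ?sqrtr_ge0.
apply/nbhs_ballP; exists (e / B) => /=; first exact: divr_gt0.
move=> y; rewrite -ball_normE /ball_/= ltr_pdivlMr// => xy Ay.
apply: le_lt_trans (gL _ _ Ax Ay) _; apply: le_lt_trans xy.
rewrite mulrC /B mulrCA [leLHS]mulrC ler_pM2l//.
apply: le_trans (enorm_le_norm _) _; rewrite mulrC ler_wpM2l//.
by rewrite lerDl.
Qed.

Definition cball x (r : R) : set 'rV[R]_n := [set y | enorm (y - x) <= r].

Lemma closed_cball x (r : R) : closed (cball x r).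
Proof.
have c : continuous (fun y : 'rV[R]_n => enorm (y - x)).
  move=> y; have h0 : y' - x @[y' --> y] --> y - x.
    exact: (cvgB cvg_id (cvg_cst _)).
  exact: (cvg_comp _ _ h0 (@enorm_continuous R n (y - x))).
exact: (closed_comp (fun y _ => c y) (@closed_le R r)).
Qed.

Lemma compact_cball x (r : R) : compact (cball x r).
Proof.
apply: bounded_closed_compact; last exact: closed_cball.
exists (r + `|x|); split; first exact: num_real.
move=> M rM y yr; apply: le_trans (ltW rM).
rewrite -(subrK x y); apply: le_trans (ler_normD _ _) _.
by rewrite lerD2r (le_trans (norm_le_enorm _)).
Qed.

Lemma refractor_argmax (K : set 'rV[R]_n) Y : K !=set0 -> compact K -> K `<=` Omega ->
  exists2 x1, K x1 & forall x, K x -> cost (x, u x) Y <= cost (x1, u x1) Y.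
Proof.
move=> K0 cK KO.
have [|x1 x1K x1m] := @EVT_max_rV R n (fun x => cost (x, u x) Y) K K0 cK.
  apply: (@lipschitz_within _ _ ((kappa + 1) * L0 + 1)).
    by rewrite addr_gt0// mulr_gt0// addr_gt0// (lt_trans ltr01).
  by move=> x x' /KO Ox /KO Ox'; exact: cost_graph_dist.
exists x1; first by rewrite inE in x1K.
by move=> x Kx; apply: x1m; rewrite inE.
Qed.

(* [A] is the gain in strict concavity; it beats both the error made in
   replacing the point Yl by a nearby Y' and the height of the graph of u
   above Z. *)
Lemma contact_in_ball Z Yb Yh Yl Y' (l A L1 mu eta : R) :
  cyl Z -> Sigma Yb -> Sigma Yh -> Sigma Yl -> Sigma Y' -> 0 <= l <= 1 ->
  slope (Yl - Z) = (1 - l) *: slope (Yb - Z) + l *: slope (Yh - Z) ->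
  (1 - l) / (2 * qden kappa (Yb - Z)) + l / (2 * qden kappa (Yh - Z)) + A
    <= (2 * qden kappa (Yl - Z))^-1 ->
  (forall x, Omega x -> cost (x, u x) Yb <= cost Z Yb) ->
  (forall x, Omega x -> cost (x, u x) Yh <= cost Z Yh) ->
  enormX (Y' - Yl) <= mu -> 0 <= A -> 0 < eta -> cball Z.1 eta `<=` Omega ->
  k * L1 ^+ 2 < 1 -> Z.2 <= u Z.1 -> u Z.1 - Z.2 <= (L1 - L0) * eta ->
  mu * (slip + tlip * W) <= A * (1 - k * L1 ^+ 2) / 2 * eta ->
  (kappa + 1) * (u Z.1 - Z.2) * (2 * Rm + kappa * tau0)
    <= q0 * A * (1 - k * L1 ^+ 2) * eta ^+ 2 ->
  exists2 x1, cball Z.1 eta x1 & F x1 Y'.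
Proof.
move=> cZ Sb Sh Sl S' /andP[l0 l1] slE thE cb ch Ymu A0 eta0 ball kL1 Zu hL mub hb.
have OZ : Omega Z.1 by case: cZ.
have ab := adm cZ Sb; have ah := adm cZ Sh; have al := adm cZ Sl; have a' := adm cZ S'.
set cP := 1 - k * L1 ^+ 2 in mub hb.
have cP0 : 0 < cP by rewrite subr_gt0.
have kp : 0 < kappa by rewrite (lt_trans ltr01).
set D1 := 2 * Rm + kappa * tau0 in hb.
have D10 : 0 < D1 by rewrite addr_gt0// mulr_gt0// (tau0_gt0 hs).
(* Points of the graph outside the ball do not beat the one above the center, so a maximum over the
   closed ball is a maximum over all of [Omega]. *)
have far x : Omega x -> eta <= enorm (x - Z.1) ->
    cost (x, u x) Y' <= cost (Z.1, u Z.1) Y'.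
  move=> Ox ew; set w := x - Z.1 in ew *; pose h := u x - Z.2.
  have wW : enorm w <= W by exact: diam.
  have eb := target_excess cZ Sb Ox (cb x Ox).
  have eh := target_excess cZ Sh Ox (ch x Ox).
  rewrite -/w -/h in eb eh.
  have w0 := enorm_ge0 w.
  have L1L0 : 0 <= L1 - L0.
    by rewrite -(pmulr_lge0 _ eta0); apply: le_trans hL; rewrite subr_ge0.
  (* Passing from [L0] to [L1] pays for the height of the graph above [Z], because [|w|] is at least
     [eta]. *)
  have hL1 : `|h| <= L1 * enorm w.
    rewrite ler_norml lerNl; apply/andP; split.
      apply: le_trans (excess_lipschitz cZ Sb wW eb) _.
      by rewrite ler_wpM2r// -subr_ge0.
    have := le_trans (ler_norm _) (refractor_lipschitz Ox OZ); rewrite -/w.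
    by have := ler_wpM2l L1L0 ew; rewrite /h; lra.
  have lcg := lcone_ge hL1; rewrite -/cP in lcg.
  have lcl := lcone_le w h.
  have lc0 : 0 <= lcone kappa w h.
    by apply: le_trans lcg; rewrite mulr_ge0 ?sqr_ge0// ltW.
  (* The convex combination of the two nonnegative excesses differs from the excess for [Yl] only in
     the coefficient of [lcone], where concavity gains [A]. *)
  have el : A * lcone kappa w h <= excess (Yl - Z) w h.
    have l1' : 0 <= 1 - l by rewrite subr_ge0.
    have m1 := mulr_ge0 l1' eb; have m2 := mulr_ge0 l0 eh.
    have m3 := ler_wpM2l lc0 thE.
    move: m1 m2 m3; rewrite /excess slE dotDl (dotZl (1 - l)) (dotZl l).
    set p := dot _ w; set p' := dot _ w; set lc := lcone _ _ _.
    by set t := _^-1; set t' := _^-1; set t'' := _^-1; lra.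
  have ed := excess_dist kappa1 T0_gt0 w h al a'.
  have VV : enormX (Yl - Z - (Y' - Z)) <= mu.
    by rewrite opprB addrA subrK enormXB.
  (* Replacing [Yl] by [Y'] uses up at most half of the gain. *)
  have e' : A * cP / 2 * enorm w ^+ 2 <= excess (Y' - Z) w h.
    have s0 : 0 < slip := slope_lip_gt0 kappa1 T0_gt0.
    have t0 : 0 < tlip := theta_lip_gt0 kappa1 T0_gt0.
    have h1 : slip * enorm w + tlip * `|lcone kappa w h| <= (slip + tlip * W) * enorm w.
      rewrite mulrDl lerD2l -mulrA ler_pM2l// (ger0_norm lc0).
      by apply: le_trans lcl _; rewrite expr2 ler_wpM2r.
    have h0' : 0 <= slip * enorm w + tlip * `|lcone kappa w h|.
      by rewrite addr_ge0// mulr_ge0// ltW.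
    have h2 := ler_pM (enormX_ge0 _) h0' VV h1.
    have h3 := ler_wpM2r w0 mub.
    have h4 : A * cP / 2 * eta * enorm w <= A * cP / 2 * enorm w ^+ 2.
      rewrite -mulrA ler_wpM2l ?divr_ge0 ?mulr_ge0 ?(ltW cP0)//.
      by rewrite expr2 ler_wpM2r.
    have h5 := ler_wpM2l A0 lcg.
    by clear thE mub hb hL kL1; lra.
  have e'0 : 0 <= excess (Y' - Z) w h.
    by apply: le_trans e'; rewrite !mulr_ge0 ?invr_ge0 ?(ltW cP0)// exprn_ge0.
  have q' := qden_gt0 kappa1 T0_gt0 a'.
  have hup : Z.2 + h <= tau0.
    by rewrite /h addrC subrK; have /andP[] := hu.1 x Ox.
  have kh := height_le hs cZ S' hup.
  have DD : enormX (Y' - (Z.1 + w, Z.2 + h)) + (enormX (Y' - Z) - kappa * h) <= D1.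
    rewrite /w /h -graphE.
    have [_ R1 _] := a'; have [_ R2 _] := adm (graph_cyl Ox) S'.
    have /andP[ux0 _] := hu.1 x Ox; have [_ /andP[_ Zt]] := cZ.
    have : kappa * (Z.2 - u x) <= kappa * tau0 by rewrite ler_pM2l//;
      clear thE mub hb hL slE el ed e' e'0 hL1 lcg lcl lc0 kL1 eb eh; lra.
    by rewrite /D1; clear thE mub hb hL slE el ed e' e'0 hL1 lcg lcl lc0 kL1 eb eh; lra.
  have gap := excess_cost_gap q' D10 kh e'0 DD.
  rewrite /w /h -graphE -/w -/h in gap.
  (* Lifting [Z] to the graph lowers the cost by at most [kappa + 1] times the height; the gap
     outweighs this loss. *)
  have /andP[_ dec] := cost_decr kappa Z.1 Y' Zu.
  have ZE : (Z.1, Z.2) = Z by rewrite -surjective_pairing.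
  rewrite ZE in dec.
  suff : (kappa + 1) * (u Z.1 - Z.2) <= 2 * qden kappa (Y' - Z) * excess (Y' - Z) w h / D1
    by clear thE mub hb hL slE el ed e' e'0 hL1 lcg lcl lc0 kL1 eb eh DD kh; lra.
  rewrite ler_pdivlMr//; apply: le_trans hb _.
  have qq : q0 <= qden kappa (Y' - Z) := qden_ge kappa1 a'.
  have ew2 : eta ^+ 2 <= enorm w ^+ 2 by rewrite lerXn2r ?nnegrE// ltW.
  have AC : 0 <= A * cP / 2 by rewrite divr_ge0// mulr_ge0// ltW.
  have h1 := le_trans (ler_wpM2l AC ew2) e'.
  have h2 : 0 <= A * cP / 2 * eta ^+ 2 by rewrite mulr_ge0// sqr_ge0.
  have := ler_pM (ltW q0_gt0) h2 qq h1.
  by move: (q0) (qden kappa _) (excess _ _ _) => a b c; lra.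
have cK := @compact_cball Z.1 eta.
have Z1K : cball Z.1 eta Z.1 by rewrite /cball /= subrr enorm0 ltW.
have [|x1 x1K x1m] := refractor_argmax Y' _ cK ball; first by exists Z.1.
exists x1 => //; apply/(refractor_mapE Y' (ball _ x1K)); split => // x Ox.
have [xe|xe] := leP (enorm (x - Z.1)) eta; first exact: x1m.
by apply: le_trans (far x Ox (ltW xe)) (x1m _ Z1K).
Qed.

(** * Images of balls and their measure *)

Lemma open_enormX Y (e : R) : open [set Y' | enormX (Y' - Y) < e].
Proof.
have c : continuous (fun Y' : ambient R n => enormX (Y' - Y)).
  move=> y; have h0 : y' - Y @[y' --> y] --> y - Y.
    exact: (cvgB cvg_id (cvg_cst _)).
  exact: (cvg_comp _ _ h0 (@enormX_continuous R n (y - Y))).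
exact: (open_comp (fun y _ => c y) (@open_lt R e)).
Qed.

Lemma open_eneigh (mu : R) (A : set (ambient R n)) : open (eneigh mu A).
Proof.
have -> : eneigh mu A = \bigcup_(Y in A) [set X | enormX (X - Y) < mu].
  by apply/seteqP; split => X [Y AY h]; exists Y.
by apply: bigcup_open => Y _; exact: open_enormX.
Qed.

Lemma target_closed : closed Sigma.
Proof. exact: compact_closed (@norm_hausdorff _ _) (target_compact hs). Qed.

(* A limit Y of contact directions is supporting at the maximum point over K of
   the cost towards Y. *)
Lemma refractor_image_closed (K : set 'rV[R]_n) : compact K -> K `<=` Omega ->
  closed (refractor_image kappa Omega Sigma u K).
Proof.
move=> cK KO Y clY.
have near_image (e : R) : 0 < e -> exists x' Y', [/\ K x', F x' Y' & enormX (Y' - Y) < e].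
  move=> e0; have [|Y' [[x' Kx' Fx'] h]] := clY [set Y' | enormX (Y' - Y) < e].
    apply: open_nbhs_nbhs; split; first exact: open_enormX.
    by rewrite /= subrr (_ : enormX 0 = 0)// /enormX /= enorm0 !expr0n addr0 sqrtr0.
  by exists x', Y'.
have SY : Sigma Y.
  by apply: target_closed => B /clY[Y' [[x' _ [SY' _]] BY']]; exists Y'.
have K0 : K !=set0 by have [x' [_ [Kx' _ _]]] := near_image 1 ltr01; exists x'.
have [x1 Kx1 x1m] := refractor_argmax Y K0 cK KO.
exists x1 => //; apply/(refractor_mapE Y (KO _ Kx1)); split => // x Ox.
apply/ler_addgt0Pr => e e0.
have kp : 0 < kappa + 1 by rewrite addr_gt0// (lt_trans ltr01).
have e'0 : 0 < e / (2 * (kappa + 1)) by rewrite divr_gt0// mulr_gt0.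
have [x' [Y' [Kx' Fx' YY']]] := near_image _ e'0.
have [_ /(_ x Ox) h1] := (refractor_mapE Y' (KO _ Kx')).1 Fx'.
have d X : `|cost X Y' - cost X Y| <= e / 2.
  apply: le_trans (cost_target_dist _ _ _) _.
  have -> : e / 2 = (kappa + 1) * (e / (2 * (kappa + 1))) by field; rewrite gt_eqF.
  by rewrite ler_pM2l// ltW.
have := d (x, u x); have := d (x', u x'); rewrite !ler_norml.
by move=> /andP[_ h2] /andP[h3 _]; have := x1m _ Kx'; lra.
Qed.

Lemma open_measurable_borel (A : set (ambient R n)) : open A ->
  measurable (A : set (borel R n)).
Proof. by move=> oA; exact: sub_sigma_algebra. Qed.

Lemma closed_measurable_borel (A : set (ambient R n)) : closed A ->
  measurable (A : set (borel R n)).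
Proof.
move=> cA; rewrite -(setCK A); apply: measurableC.
by apply: open_measurable_borel; exact: closed_openC.
Qed.

(** The open ball is a countable union of closed balls, whose images are closed. Measurability is
    required to compare measures by inclusion. *)
Lemma measurable_refractor_image x (r : R) : eball x r `<=` Omega ->
  measurable (refractor_image kappa Omega Sigma u (eball x r) : set (borel R n)).
Proof.
move=> rO.
have sub m : cball x (r - m.+1%:R^-1) `<=` eball x r.
  by move=> y /le_lt_trans; apply; rewrite ltrBlDr ltrDl invr_gt0.
rewrite (_ : refractor_image _ _ _ _ _ =
  \bigcup_m refractor_image kappa Omega Sigma u (cball x (r - m.+1%:R^-1))).
  apply: bigcup_measurable => m _; apply: closed_measurable_borel.
  apply: refractor_image_closed; first exact: compact_cball.
  exact: subset_trans rO.
apply/seteqP; split => Y; last by move=> [m _ [y /sub ry Fy]]; exists y.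
move=> [y ry Fy]; pose e := r - enorm (y - x).
have e0 : 0 < e by rewrite subr_gt0.
have [m me] : exists m : nat, m.+1%:R^-1 < e.
  exists (Num.truncn e^-1); rewrite invf_plt ?posrE//; exact: truncnS_gt.
by exists m => //; exists y => //; rewrite /cball /= lerBrDr -lerBrDl ltW.
Qed.

Lemma compactly_contained_eball x (r : R) : cball x r `<=` Omega ->
  compactly_contained (eball x r) Omega.
Proof.
move=> rO; have sub : closure (eball x r) `<=` cball x r.
  rewrite [X in _ `<=` X](closure_id _).1; last exact: closed_cball.
  by apply: closureS => y /ltW.
split; last exact: subset_trans rO.
exact: subclosed_compact (@closed_closure _ _) (@compact_cball x r) sub.
Qed.

(** The contact assumption places the tube around the middle of the segment inside the image of a
    ball, so monotonicity links the two growth conditions. The radius is doubled to fit the closed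
    ball of contact points into an open one. *)
Lemma measure_comparison (sigma : {measure set (borel R n) -> \bar R})
    (U : set (ambient R n)) (Ct C0 q mu0 mu eta : R) Yb Yh Z :
  target_growth kappa tau0 Omega Sigma s sigma U Ct mu0 ->
  source_growth kappa Omega Sigma u sigma C0 q ->
  Sigma Yb -> Sigma Yh -> U Z -> cyl Z -> 0 < mu <= mu0 -> 0 < eta ->
  cball Z.1 (2 * eta) `<=` Omega ->
  (forall (l : R) Y', 4^-1 <= l <= 3 / 4 -> Sigma Y' ->
     enormX (Y' - Ypath kappa s Yb Yh Z l) <= mu ->
     exists2 x1, cball Z.1 eta x1 & F x1 Y') ->
  Ct * mu ^+ (n - 1) * enormX (Yb - Yh) <= C0 * (2 * eta) `^ (n%:R / q).
Proof.
move=> tg sg Sb Sh UZ cZ mu_bd eta0 ball contact.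
have eta2 : 0 < 2 * eta by rewrite mulr_gt0.
have sub : eball Z.1 (2 * eta) `<=` Omega by move=> y /ltW; exact: ball.
have := sg Z.1 _ eta2 (compactly_contained_eball ball).
have := tg Yb Yh Z mu Sb Sh UZ cZ mu_bd.
move=> h1 h2; rewrite -lee_fin; apply: le_trans h1 (le_trans _ h2).
apply: le_measure; rewrite ?inE.
- apply: measurableI; first exact: open_measurable_borel (@open_eneigh _ _).
  exact: closed_measurable_borel target_closed.
- exact: measurable_refractor_image.
move=> Y' [[Yl [_ [l ll ->]] Ymu] SY'].
have [x1 x1e Fx1] := contact l Y' ll SY' (ltW Ymu).
exists x1 => //; rewrite /eball /=; apply: le_lt_trans x1e _.
by rewrite ltr_pMl// ltr1n.
Qed.

(** Semiconvexity at [x] and at [x + w] traps the increment of [u] between two linear functions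
    whose slopes differ by a Hoelder term, so the slope of any supporting hyperboloid is the
    gradient. The bound on [rho] keeps distances at most 1, where a Lipschitz bound implies a
    Hoelder one. *)
Lemma refractor_C1_holder (a H : R) x0 (rho : R) : 0 < a <= 1 -> 0 < H ->
  rho <= 2^-1 -> eball x0 rho `<=` Omega ->
  (forall x y Yx Yy, eball x0 rho x -> eball x0 rho y -> F x Yx -> F y Yy ->
     enormX (Yx - Yy) <= H * enorm (x - y) `^ a) ->
  C1_holder a (eball x0 rho) u.
Proof.
move=> /andP[a0 a1] H0 rho2 BO FH.
have sl0 : 0 < slip := slope_lip_gt0 kappa1 T0_gt0.
have small x y : eball x0 rho x -> eball x0 rho y ->
    enorm (x - y) <= enorm (x - y) `^ a.
  move=> Bx By; have w0 := enorm_ge0 (x - y).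
  have w1 : enorm (x - y) <= 1.
    apply: le_trans (enorm_triangle x x0 y) _; rewrite (enormB x0 y).
    by move: Bx By; rewrite /eball /=; lra.
  have [->|wn0] := eqVneq (enorm (x - y)) 0; first exact: powR_ge0.
  rewrite -[leLHS]powRr1//; apply: ger_powR => //.
  by rewrite lt_def wn0 w0.
pose H' := slip * (H + 1 + L0).
have H'0 : 0 < H' by rewrite mulr_gt0// !addr_gt0.
pose dir x Y := slope (Y - (x, u x)).
have dirH x y Yx Yy : eball x0 rho x -> eball x0 rho y -> F x Yx -> F y Yy ->
    enorm (dir x Yx - dir y Yy) <= H' * enorm (x - y) `^ a.
  move=> Bx By Fx Fy; have Ox := BO _ Bx; have Oy := BO _ By.
  apply: le_trans (slope_dist kappa1 T0_gt0 (adm (graph_cyl Ox) (refractor_map_target Fx))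
    (adm (graph_cyl Oy) (refractor_map_target Fy))) _.
  rewrite /H' -mulrA ler_pM2l//.
  have -> : Yx - (x, u x) - (Yy - (y, u y)) =
      (Yx - Yy) - (x - y, u x - u y) :> ambient R n.
    rewrite -[(x - y, u x - u y)]/((x, u x) - (y, u y)).
    by rewrite !opprB [(y, u y) - Yy]addrC addrACA [- (x, u x) + _]addrC.
  apply: le_trans (enormXD _ _) _; rewrite enormXN.
  have h1 := FH _ _ _ _ Bx By Fx Fy.
  have h2 := enormX_le ((x - y, u x - u y) : ambient R n); rewrite /= in h2.
  have h3 := refractor_lipschitz Ox Oy.
  have h4 := small _ _ Bx By.
  have h5 := ler_wpM2l (ltW L0_gt0) h4.
  by lra.
have ugrad x Y : eball x0 rho x -> F x Y ->
    differentiable u x /\ grad u x = dir x Y.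
  move=> Bx Fx; apply: expansion_grad => e e0.
  pose H2 := H' + q0^-1.
  have H20 : 0 < H2 by rewrite addr_gt0// invr_gt0.
  (* The first radius keeps [x + w] in the ball, the second makes [H2 |w|^a <= e]. *)
  exists (Num.min (rho - enorm (x - x0)) ((e / H2) `^ a^-1)).
    by rewrite lt_min subr_gt0 Bx powR_gt0// divr_gt0.
  move=> w; rewrite lt_min => /andP[w1 w2].
  have w0 := enorm_ge0 w.
  have Bxw : eball x0 rho (x + w).
    rewrite /eball /= addrAC; apply: le_lt_trans (enormD _ _) _; lra.
  have Ox := BO _ Bx; have Oxw := BO _ Bxw.
  have [Yw Fw] := refractor_map_neq0 Oxw.
  have lo := refractor_lower Ox Oxw Fx.
  have up := refractor_lower Oxw Ox Fw.
  have xw : x + w - x = w by rewrite addrC addKr.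
  have wx : x - (x + w) = - w by rewrite opprD addNKr.
  have dH := dirH _ _ _ _ Bxw Bx Fw Fx; rewrite xw in lo dH.
  rewrite wx dotNr enormN in up.
  have sm := small _ _ Bxw Bx; rewrite xw in sm.
  rewrite -/(dir x Y) in lo; rewrite -/(dir (x + w) Yw) in up.
  have dd : `|dot (dir (x + w) Yw) w - dot (dir x Y) w| <=
      H' * enorm w `^ a * enorm w.
    rewrite -dotBl; apply: le_trans (dot_le _ _) _.
    by rewrite ler_wpM2r.
  have ea : H2 * enorm w `^ a <= e.
    have : enorm w `^ a <= e / H2.
      have -> : e / H2 = ((e / H2) `^ a^-1) `^ a.
        by rewrite -powRrM mulVf ?gt_eqF// powRr1// divr_ge0// ltW.
      by apply: ge0_ler_powR; rewrite ?nnegrE ?powR_ge0// ltW.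
    by rewrite ler_pdivlMr// mulrC.
  have ew := ler_wpM2r w0 ea.
  have q2 : enorm w ^+ 2 / (2 * q0) <= q0^-1 * enorm w `^ a * enorm w.
    have h1 : enorm w ^+ 2 <= enorm w `^ a * enorm w.
      by rewrite expr2 ler_wpM2r.
    have iq : 0 <= q0^-1 by rewrite invr_ge0 ltW.
    have h2 := ler_wpM2l iq h1.
    have h3 : 0 <= q0^-1 * enorm w ^+ 2 by rewrite mulr_ge0 ?sqr_ge0.
    by rewrite invfM; move: (q0^-1) h2 h3 => i; lra.
  move: dd; rewrite !ler_norml => /andP[d1 d2].
  rewrite /H2 in ew; apply/andP; split; last by lra.
  have : 0 <= H' * enorm w `^ a * enorm w.
    by rewrite mulr_ge0// mulr_ge0 ?powR_ge0// ltW.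
  by lra.
split=> [x Bx|].
  by have [Y Fx] := refractor_map_neq0 (BO _ Bx); have [] := ugrad x Y Bx Fx.
exists H' => x y Bx By.
have [Yx Fx] := refractor_map_neq0 (BO _ Bx).
have [Yy Fy] := refractor_map_neq0 (BO _ By).
by rewrite (ugrad x Yx Bx Fx).2 (ugrad y Yy By Fy).2; exact: dirH.
Qed.

(** The radius [r] is only an upper bound for the distance of the base points, so that coinciding
    base points can be treated with [r] tending to 0. The four lower bounds on [M] control, in
    order, the height of the graph in terms of [eta], the displacement [mu], the loss of cost at the
    center, and [mu <= mu0]. *)
Lemma distance_estimate (Xs : ambient R n) (U Ur : set (ambient R n))
    (c1 c2 delta L1 M mu0 Ct C0 q r : R)
    (sigma : {measure set (borel R n) -> \bar R}) xb xh Yb Yh :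
  (2 <= n)%N -> 0 < c1 -> 0 < c2 -> 0 < delta ->
  (forall Ybar Yhat Z x (lambda : R), Sigma Ybar -> Sigma Yhat ->
      Ur Z -> cyl Z ->
      Omega x -> enorm (x - Z.1) <= c2 -> 4^-1 <= lambda <= 3 / 4 ->
      phi kappa x (Ypath kappa s Ybar Yhat Z lambda) Z <=
        Num.max (phi kappa x Ybar Z) (phi kappa x Yhat Z)
        - c1 * enormX (Ybar - Yhat) ^+ 2 * enorm (x - Z.1) ^+ 2) ->
  (forall Z, enorm (Z.1 - Xs.1) < delta / 2 -> `|Z.2 - Xs.2| <= 2 * L0 * delta ->
     [/\ U Z, Ur Z & 0 <= Z.2]) ->
  u Xs.1 = Xs.2 -> cball Xs.1 (3 / 2 * delta) `<=` Omega ->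
  L0 < L1 -> k * L1 ^+ 2 < 1 -> 1 <= M ->
  (slip + q0^-1) * (2 * Rm) ^+ 2 * delta <= (L1 - L0) * M ->
  2 * (slip + tlip * W) <= c1 * (1 - k * L1 ^+ 2) * M ->
  (kappa + 1) * (slip + q0^-1) * (2 * Rm + kappa * tau0)
    <= q0 * c1 * (1 - k * L1 ^+ 2) * M ->
  (2 * Rm) ^+ 2 * delta <= mu0 * M ->
  target_growth kappa tau0 Omega Sigma s sigma U Ct mu0 ->
  source_growth kappa Omega Sigma u sigma C0 q ->
  eball Xs.1 (delta / 2) xb -> eball Xs.1 (delta / 2) xh -> F xb Yb -> F xh Yh ->
  0 < r -> enorm (xb - xh) <= r -> r <= enormX (Yb - Yh) ->
  (2 * M / delta) ^+ 2 * r <= enormX (Yb - Yh) ->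
  Ct * (enormX (Yb - Yh) ^+ 2 * (M * Num.sqrt (r / enormX (Yb - Yh))) / M) ^+ (n - 1)
    * enormX (Yb - Yh)
  <= C0 * (2 * (M * Num.sqrt (r / enormX (Yb - Yh)))) `^ (n%:R / q).
Proof.
move=> n2 c10 c20 delta0 reg hZ uXs ball L01 kL1 M1 Mi Mii Miii Miv tg sg
  Bb Bh Fb Fh r0 rb rd rM.
set d := enormX (Yb - Yh) in rd rM *; set eta := M * Num.sqrt (r / d).
have d0 : 0 < d by exact: lt_le_trans rd.
have M0 : 0 < M by exact: lt_le_trans M1.
have eta0 : 0 < eta by rewrite mulr_gt0// sqrtr_gt0 divr_gt0.
(* All later comparisons use this identity instead of the square root. *)
have eta2 : eta ^+ 2 * d = M ^+ 2 * r.
  rewrite exprMn sqr_sqrtr; last by rewrite divr_ge0// ltW.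
  by field; rewrite gt_eqF.
have etad : eta <= delta / 2.
  rewrite -(@ler_pXn2r _ 2) ?nnegrE ?divr_ge0 ?(ltW eta0) ?(ltW delta0)//.
  rewrite -(ler_pM2r d0) eta2.
  have -> : M ^+ 2 * r = (2 * M / delta) ^+ 2 * r * (delta / 2) ^+ 2.
    by field; rewrite gt_eqF.
  by rewrite [leRHS]mulrC ler_wpM2r ?sqr_ge0.
have half : 0 < delta / 2 by rewrite divr_gt0.
have inO x : enorm (x - Xs.1) <= 3 / 2 * delta -> Omega x by exact: ball.
have Ob : Omega xb by apply: inO; move: Bb; rewrite /eball /=;
  clear Mi Mii Miii Miv rM kL1; lra.
have Oh : Omega xh by apply: inO; move: Bh; rewrite /eball /=;
  clear Mi Mii Miii Miv rM kL1; lra.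
have OXs : Omega Xs.1 by apply: inO; rewrite subrr enorm0; clear Mi Mii Miii Miv rM kL1; lra.
have Sb := refractor_map_target Fb; have Sh := refractor_map_target Fh.
have bh : enorm (xb - xh) <= delta.
  apply: le_trans (enorm_triangle xb Xs.1 xh) _; rewrite (enormB Xs.1).
  by move: Bb Bh; rewrite /eball /=; clear Mi Mii Miii Miv rM kL1; lra.
have [t [Z [t01 ZE OZ [cb ch] [Zu Zl]]]] := crossing_point Ob Oh Fb Fh.
have /andP[t0 t1] := t01.
have ZX : enorm (Z.1 - Xs.1) < delta / 2.
  have -> : Z.1 - Xs.1 = (1 - t) *: (xb - Xs.1) + t *: (xh - Xs.1).
    by apply/rowP => i; rewrite ZE !mxE; ring.
  apply: le_lt_trans (enormD _ _) _; rewrite !enormZ (ger0_norm t0) ger0_norm ?subr_ge0//.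
  move: Bb Bh; rewrite /eball /=; set a := enorm _; set b := enorm _ => ha hb.
  have : (1 - t) * a <= (1 - t) * Num.max a b.
    by rewrite ler_wpM2l ?subr_ge0// le_max lexx.
  have : t * b <= t * Num.max a b by rewrite ler_wpM2l// le_max lexx orbT.
  have : Num.max a b < delta / 2 by rewrite gt_max ha hb.
  by clear Mi Mii Miii Miv rM kL1; lra.
have Z2 : `|Z.2 - Xs.2| <= 2 * L0 * delta.
  have h1 := refractor_lipschitz OZ OXs; have h2 := refractor_lipschitz Ob OXs.
  have h3 : L0 * enorm (xb - xh) <= L0 * delta by rewrite ler_pM2l.
  have h4 : L0 * enorm (Z.1 - Xs.1) <= L0 * (delta / 2) by rewrite ler_pM2l// ltW.
  have h5 : L0 * enorm (xb - Xs.1) <= L0 * (delta / 2) by rewrite ler_pM2l// ltW.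
  have h6 : 0 <= L0 * delta by rewrite mulr_ge0// ltW.
  move: h1 h2; rewrite !ler_norml uXs => /andP[h7 h8] /andP[h9 h10].
  by apply/andP; split; clear Mi Mii Miii Miv rM kL1; lra.
have [UZ UrZ Z0] := hZ Z ZX Z2.
have cZ : cyl Z.
  split => //; rewrite Z0/=; apply: le_trans Zu _.
  by have /andP[] := hu.1 _ OZ.
have [_ Rb _] := adm cZ Sb; have [_ Rh _] := adm cZ Sh.
have dR : d <= 2 * Rm.
  have := enormXD (Yb - Z) (- (Yh - Z)); rewrite enormXN opprB addrA subrK -/d;
    clear Mi Mii Miii Miv rM kL1; lra.
have iq0 : 0 < q0^-1 by rewrite invr_gt0.
have sl0 : 0 < slip := slope_lip_gt0 kappa1 T0_gt0.
have tl0 : 0 < tlip := theta_lip_gt0 kappa1 T0_gt0.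
have Cs0 : 0 < slip + q0^-1 by rewrite addr_gt0.
have cP0 : 0 < 1 - k * L1 ^+ 2 by rewrite subr_gt0.
pose e2 := d ^+ 2 * eta ^+ 2.
have e20 : 0 < e2 by rewrite mulr_gt0// exprn_gt0.
(* Since [|xb - xh| <= r <= d], the crossing height is at most a constant times [d r], and
   [d r M <= d^2 eta^2] because [1 <= M]. *)
have h0 : u Z.1 - Z.2 <= (slip + q0^-1) * e2 / M.
  have := crossing_height Ob Oh Sb Sh t01 ZE cZ cb ch; rewrite -/d.
  set w := enorm (xb - xh) in rb *; have w0 : 0 <= w by exact: enorm_ge0.
  have h1 : slip * d * w <= slip * d * r by rewrite ler_pM2l// mulr_gt0.
  have h2 : w ^+ 2 / q0 <= d * r / q0.
    rewrite ler_pM2r// expr2 ler_pM//; exact: le_trans rb rd.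
  have h3 : d * r * M <= e2.
    have -> : e2 = d * (eta ^+ 2 * d) by rewrite /e2; ring.
    rewrite eta2 -mulrA ler_pM2l// mulrC ler_pM2r// expr2.
    by rewrite ler_peMl// ltW.
  have h4 : (slip + q0^-1) * (d * r) <= (slip + q0^-1) * e2 / M.
    by rewrite -mulrA ler_pM2l// ler_pdivlMr.
  by clear Mi Mii Miii Miv rM kL1 eta2; lra.
have d2 : d ^+ 2 <= (2 * Rm) ^+ 2.
  by rewrite lerXn2r ?nnegrE ?mulr_ge0 ?(ltW d0) ?(ltW Rm_gt0).
have etadelta : eta <= delta by clear Mi Mii Miii Miv rM kL1 h0 eta2 d2; lra.
apply: (measure_comparison tg sg Sb Sh UZ cZ _ eta0).
- apply/andP; split; first by rewrite divr_gt0// mulr_gt0// exprn_gt0.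
  rewrite ler_pdivrMr//; apply: le_trans Miv.
  by rewrite ler_pM ?sqr_ge0// ltW.
- move=> x xZ; apply: inO; apply: le_trans (enorm_triangle x Z.1 Xs.1) _.
  by move: xZ; rewrite /cball /=; clear Mi Mii Miii Miv rM kL1 h0 eta2 d2; lra.
move=> l Y' l14 SY' Ymu; have /andP[l1 l2] := l14.
have l01 : 0 <= l <= 1 by apply/andP; split; clear Mi Mii Miii Miv rM kL1 h0 eta2 d2; lra.
have [_ Sl] := param_path hs Sb Sh cZ l01.
have slE := slope_Ypath hs T0_gt0 b0_gt0 adm cZ Sb Sh l01.
have A0 : 0 < c1 * d ^+ 2 by rewrite mulr_gt0// exprn_gt0.
have thE : (1 - l) / (2 * qden kappa (Yb - Z)) + l / (2 * qden kappa (Yh - Z)) +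
    c1 * d ^+ 2 <= (2 * qden kappa (Ypath kappa s Yb Yh Z l - Z))^-1.
  (* Radius [c2] is the range of the regularity condition, while [delta] keeps [Z.1 + w] within
     [3/2 delta] of the center, hence in [Omega]. *)
  apply: (@theta_concave _ _ kappa T0 Rm b0 kappa1 T0_gt0 b0_gt0 _ _ _ _ _ _
    (Num.min c2 delta) n2 (adm cZ Sb) (adm cZ Sh) (adm cZ Sl) slE) => //.
  - move=> sE; have := slope_target_inj hs b0_gt0 adm cZ Sb Sh sE.
    move=> YE; move: d0; rewrite /d YE subrr.
    by rewrite (_ : enormX 0 = 0) ?ltxx// /enormX /= enorm0 !expr0n addr0 sqrtr0.
  - by rewrite lt_min c20.
  move=> w; rewrite lt_min => /andP[w1 w2].
  have zw : Z.1 + w - Z.1 = w by rewrite addrC addKr.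
  have := reg Yb Yh Z (Z.1 + w) l Sb Sh UrZ cZ; rewrite zw; apply => //.
    apply: inO; rewrite addrAC; apply: le_trans (enormD _ _) _;
      clear Mi Mii Miii Miv rM kL1 h0 eta2 d2; lra.
  exact: ltW.
have sup xx Y x : Omega xx -> F xx Y -> cost Z Y = cost (xx, u xx) Y -> Omega x ->
    cost (x, u x) Y <= cost Z Y.
  by move=> Oxx Fxx -> Ox; have [_] := (refractor_mapE Y Oxx).1 Fxx; exact.
apply: (@contact_in_ball Z Yb Yh _ Y' l (c1 * d ^+ 2) L1 _ eta cZ Sb Sh Sl SY' l01
  slE thE _ _ Ymu (ltW A0) eta0 _ kL1 Zu) => //.
- by move=> x; exact: sup Ob Fb cb.
- by move=> x; exact: sup Oh Fh ch.
- move=> x xZ; apply: inO; apply: le_trans (enorm_triangle x Z.1 Xs.1) _.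
  by move: xZ; rewrite /cball /=; clear Mi Mii Miii Miv rM kL1 thE slE h0 eta2 d2; lra.
- apply: le_trans h0 _; rewrite ler_pdivrMr// mulrAC.
  have h1 : e2 <= (2 * Rm) ^+ 2 * delta * eta.
    have h : d ^+ 2 * eta <= (2 * Rm) ^+ 2 * delta.
      by rewrite ler_pM ?sqr_ge0 ?(ltW eta0).
    by have := ler_wpM2r (ltW eta0) h; rewrite /e2;
      clear Mi Mii Miii Miv rM kL1 eta2 d2 h thE slE; lra.
  have h2 := ler_wpM2l (ltW Cs0) h1; have h3 := ler_wpM2r (ltW eta0) Mi;
    clear Mi Mii Miii Miv rM kL1 eta2 d2 h1 thE slE; lra.
- have h1 := ler_wpM2r (ltW eta0) (ler_wpM2r (sqr_ge0 d) Mii).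
  have -> : d ^+ 2 * eta / M * (slip + tlip * W) =
     d ^+ 2 * eta * (slip + tlip * W) / M by rewrite mulrAC.
  rewrite ler_pdivrMr//; clear Mi Mii Miii Miv rM kL1 eta2 d2 thE slE h0; lra.
have kp : 0 < kappa + 1 by rewrite addr_gt0// (lt_trans ltr01).
have D10 : 0 < 2 * Rm + kappa * tau0.
  by rewrite addr_gt0 ?mulr_gt0 ?(tau0_gt0 hs)// (lt_trans ltr01).
have h1 : (kappa + 1) * (u Z.1 - Z.2) * (2 * Rm + kappa * tau0) <=
    (kappa + 1) * ((slip + q0^-1) * e2 / M) * (2 * Rm + kappa * tau0).
  by rewrite ler_pM2r// ler_pM2l.
apply: le_trans h1 _.
have -> : (kappa + 1) * ((slip + q0^-1) * e2 / M) * (2 * Rm + kappa * tau0) =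
  (kappa + 1) * (slip + q0^-1) * (2 * Rm + kappa * tau0) * e2 / M by ring.
rewrite ler_pdivrMr//; have := ler_wpM2r (ltW e20) Miii; rewrite /e2;
  clear Mi Mii Miii Miv rM kL1 eta2 d2 thE slE h0; lra.
Qed.

End refractor.

(** * The exponent *)

Section exponent.
Context {R : realType}.
Variables (n : nat) (q : R).
Hypotheses (n_ge2 : (2 <= n)%N) (q_ge1 : 1 <= q) (q_lt : q < n%:R / (n%:R - 1)).

Local Notation alpha := (holder_exponent n q).

Let q_gt0 : 0 < q. Proof. exact: lt_le_trans ltr01 q_ge1. Qed.

Let n1_gt0 : 0 < n%:R - 1 :> R.
Proof. by rewrite subr_gt0 ltr1n. Qed.

Let nq_gt0 : 0 < n%:R / (2 * q).
Proof. by rewrite divr_gt0 ?mulr_gt0// ltr0n; exact: ltnW. Qed.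

(** The total power of [d] once the growth inequality is solved for [d]; the power of [r] is then
    [n / (2 q) - (n - 1) / 2]. *)
Definition holder_denom : R := 1 + 3 / 2 * (n%:R - 1) + n%:R / (2 * q).

Lemma holder_denom_gt0 : 0 < holder_denom.
Proof. by have := n1_gt0; have := nq_gt0; rewrite /holder_denom; lra. Qed.

(** The upper bound on [q] says exactly that [n / q > n - 1]. *)
Lemma holder_exponent_gt0 : 0 < alpha.
Proof.
rewrite /holder_exponent divr_gt0 ?holder_denom_gt0// subr_gt0.
have -> : n%:R / (2 * q) = n%:R / q / 2 by rewrite invfM; ring.
rewrite ltr_pM2r// ltr_pdivlMr// mulrC.
by move: q_lt; rewrite ltr_pdivlMr.
Qed.

Lemma holder_exponent_le1 : alpha <= 1.
Proof.
rewrite /holder_exponent -/holder_denom ler_pdivrMr ?holder_denom_gt0// mul1r.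
by rewrite /holder_denom; have := n1_gt0; lra.
Qed.

Definition holder_constant (C0 Ct M : R) : R :=
  (C0 / Ct * (2 * M) `^ (n%:R / q)) `^ holder_denom^-1.

Lemma holder_constant_gt0 C0 Ct M : 0 < C0 -> 0 < Ct -> 0 < M ->
  0 < holder_constant C0 Ct M.
Proof.
by move=> C00 Ct0 M0; rewrite powR_gt0// mulr_gt0 ?divr_gt0// powR_gt0// mulr_gt0.
Qed.

(* Taking logarithms makes the inequality linear in ln d and ln r. *)
Lemma solve_growth C0 Ct M d r : 0 < C0 -> 0 < Ct -> 0 < M -> 0 < d -> 0 < r ->
  Ct * (d ^+ 2 * (M * Num.sqrt (r / d)) / M) ^+ (n - 1) * d
    <= C0 * (2 * (M * Num.sqrt (r / d))) `^ (n%:R / q) ->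
  d <= holder_constant C0 Ct M * r `^ alpha.
Proof.
move=> C00 Ct0 M0 d0 r0.
have rd0 : 0 < r / d by rewrite divr_gt0.
have s0 : 0 < Num.sqrt (r / d) by rewrite sqrtr_gt0.
have lns : ln (Num.sqrt (r / d)) = (ln r - ln d) / 2.
  have : ln (Num.sqrt (r / d) ^+ 2) = ln r - ln d.
    by rewrite sqr_sqrtr ?(ltW rd0)// ln_div.
  by rewrite lnXn// mulr2n => <-; field.
have -> : d ^+ 2 * (M * Num.sqrt (r / d)) / M = d ^+ 2 * Num.sqrt (r / d).
  by field; rewrite gt_eqF.
have -> : 2 * (M * Num.sqrt (r / d)) = 2 * M * Num.sqrt (r / d) by rewrite mulrA.
have d20 : 0 < d ^+ 2 by rewrite exprn_gt0.
have ds0 : 0 < d ^+ 2 * Num.sqrt (r / d) by rewrite mulr_gt0.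
have M20 : 0 < 2 * M by rewrite mulr_gt0.
have Ms0 : 0 < 2 * M * Num.sqrt (r / d) by rewrite mulr_gt0.
have p0 : 0 < (2 * M) `^ (n%:R / q) by rewrite powR_gt0.
have CC0 : 0 < C0 / Ct by rewrite divr_gt0.
have X0 : 0 < (d ^+ 2 * Num.sqrt (r / d)) ^+ (n - 1) by rewrite exprn_gt0.
have P0 : 0 < (2 * M * Num.sqrt (r / d)) `^ (n%:R / q) by rewrite powR_gt0.
have lnX : ln (d ^+ 2 * Num.sqrt (r / d)) = ln d *+ 2 + (ln r - ln d) / 2.
  by rewrite lnM ?posrE// lnXn// lns.
have lnP : ln (2 * M * Num.sqrt (r / d)) = ln (2 * M) + (ln r - ln d) / 2.
  by rewrite lnM ?posrE// lns.
have CX0 : 0 < Ct * (d ^+ 2 * Num.sqrt (r / d)) ^+ (n - 1) by rewrite mulr_gt0.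
rewrite -ler_ln ?posrE; [|exact: mulr_gt0|exact: mulr_gt0].
rewrite (lnM (x := _ * _)) ?posrE// lnM ?posrE// lnXn// lnX.
rewrite lnM ?posrE// ln_powR lnP => h.
have K0 := holder_constant_gt0 C00 Ct0 M0.
have ra0 : 0 < r `^ alpha by rewrite powR_gt0.
rewrite -ler_ln ?posrE; [|by []|exact: mulr_gt0].
rewrite lnM ?posrE// !ln_powR lnM ?posrE// ln_div ?posrE// ln_powR.
have S0 := holder_denom_gt0.
rewrite -(ler_pM2l S0) mulrDr mulrA mulfV ?gt_eqF// mul1r mulrA.
have -> : holder_denom * alpha = n%:R / (2 * q) - (n%:R - 1) / 2.
  by rewrite /holder_exponent -/holder_denom mulrC divfK// gt_eqF.
move: h; rewrite -(mulr_natl _ (n - 1)) natrB ?(ltnW n_ge2)// mulr2n /holder_denom.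
have -> : n%:R / (2 * q) = n%:R / q / 2 by rewrite invfM; ring.
move: (ln d) (ln r) (ln C0) (ln Ct) (ln (2 * M)) (n%:R / q) => D r' c c' m p.
by move: (n%:R) => N; lra.
Qed.

End exponent.

(** * Hoelder regularity *)

Theorem theorem5p4 (R : realType) (n : nat) (q : R) (n_ge2 : (2 <= n)%N)
    (q_ge1 : 1 <= q) (q_lt : q < n%:R / (n%:R - 1)) :
  0 < holder_exponent n q /\
  exists C1 : R -> R -> R -> R,
  (forall C0 Ct M : R, 0 < C0 -> 0 < Ct -> 0 < M -> 0 < C1 C0 Ct M) /\
  forall (kappa tau0 tau1 omega : R) (Omega : set 'rV[R]_n)
    (Sigma : set (ambient R n)) (s : ambient R n -> ambient R n -> R),
  setting kappa tau0 tau1 omega Omega Sigma s ->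
  forall Xstar : ambient R n,
  cylinder Omega tau0 Xstar ->
  regular_from kappa tau0 Omega Sigma s Xstar ->
  forall (U : set (ambient R n)) (mu0 : R), nbhs Xstar U -> 0 < mu0 ->
  exists delta M C2 : R,
    [/\ 0 < delta, 0 < M, 0 < C2 & eball Xstar.1 (delta / 2) `<=` Omega] /\
    forall (u : 'rV[R]_n -> R)
      (sigma : {measure set (borel R n) -> \bar R}) (Ct C0 : R),
    parallel_refractor kappa tau0 Omega Sigma u ->
    u Xstar.1 = Xstar.2 ->
    radon_on Sigma sigma ->
    0 < Ct -> target_growth kappa tau0 Omega Sigma s sigma U Ct mu0 ->
    0 < C0 -> source_growth kappa Omega Sigma u sigma C0 q ->
    (forall (xbar xhat : 'rV[R]_n) (Ybar Yhat : ambient R n),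
       eball Xstar.1 (delta / 2) xbar -> eball Xstar.1 (delta / 2) xhat ->
       refractor_map kappa Omega Sigma u xbar Ybar ->
       refractor_map kappa Omega Sigma u xhat Yhat ->
       Num.max 1 (Num.max ((2 * M / delta) ^+ 2) ((2 * M / C2) ^+ 2))
         * enorm (xbar - xhat) <= enormX (Ybar - Yhat) ->
       enormX (Ybar - Yhat)
         <= C1 C0 Ct M * enorm (xbar - xhat) `^ holder_exponent n q) /\
    C1_holder (holder_exponent n q) (eball Xstar.1 (delta / 2)) u.
Proof.
have a0 := holder_exponent_gt0 n_ge2 q_ge1 q_lt.
have a1 := holder_exponent_le1 n_ge2 q_ge1.
set a := holder_exponent n q in a0 a1 *.
split => //; exists (holder_constant n q); split.
  by move=> C0 Ct M; exact: holder_constant_gt0.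
move=> kappa tau0 tau1 omega Omega Sigma s hs Xs cXs [Ur [c1 [c2 [nUr c10 c20 reg]]]].
move=> U mu0 nU mu00.
have kappa1 := kappa_gt1 hs; have k0 := kappa_sqr1 kappa1.
have [T0 [Rm [b0 [T00 Rm0 b00 adm]]]] := admissible_setting hs.
have [W W0 diam] := source_diameter hs.
have [L0 [L00 kL0 slopeL0]] := lipschitz_slope (n := n) kappa1 T00 Rm0 b00 W0.
have [OXs /andP[Xs0 _]] := cXs.
have [rO rO0 rOO] := open_eball_sub (source_open hs) OXs.
have [rU rU0 rUU] := nbhs_ambient (filterI nU nUr).
(* [delta] is chosen before [u] is known, and the height of the base point may be 0 in the cylinder.
   The default 1 keeps [P] positive; once a refractor through the point is given, [P] is that
   height. *)
pose P := if 0 < Xs.2 then Xs.2 else 1.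
have P0 : 0 < P by rewrite /P; case: ifP.
(* The bounds keep, in order, the balls inside [Omega], the crossing point horizontally inside the
   neighborhoods, distances below 1, and the height of the crossing point inside the neighborhoods
   and nonnegative. *)
pose m := Num.min (Num.min rO rU) (Num.min 1 (Num.min rU P / (2 * L0))).
have m0 : 0 < m by rewrite !lt_min rO0 rU0 ltr01 divr_gt0 ?mulr_gt0// lt_min rU0.
pose delta := m / 2.
have delta0 : 0 < delta by rewrite divr_gt0.
have [mO mU m1 mL] : [/\ m <= rO, m <= rU, m <= 1 & m <= Num.min rU P / (2 * L0)].
  have : m <= m by [].
  by rewrite {2}/m !le_min => /andP[/andP[-> ->] /andP[-> ->]].
have mUP : 2 * L0 * delta < Num.min rU P.
  by move: mL; rewrite ler_pdivlMr ?mulr_gt0// /delta; have := mulr_gt0 L00 m0; clear -L00; lra.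
pose sk := (Num.sqrt (kappa ^+ 2 - 1))^-1.
have sk0 : 0 < sk by rewrite invr_gt0 sqrtr_gt0.
have ksk : (kappa ^+ 2 - 1) * sk ^+ 2 = 1.
  by rewrite exprVn sqr_sqrtr ?(ltW k0)// mulfV// gt_eqF.
have L0sk : L0 < sk.
  rewrite ltNge; apply/negP => skL.
  have h : sk ^+ 2 <= L0 ^+ 2 by rewrite lerXn2r ?nnegrE ?(ltW sk0) ?(ltW L00).
  by have := ler_wpM2l (ltW k0) h; clear -kL0 ksk; lra.
(* The midpoint leaves room both above [L0] and below the asymptotic slope. *)
pose L1 := (L0 + sk) / 2.
have L01 : L0 < L1 by rewrite /L1; clear -L0sk; lra.
have kL1 : (kappa ^+ 2 - 1) * L1 ^+ 2 < 1.
  rewrite -[ltRHS]ksk ltr_pM2l// ltrXn2r// ?nnegrE; rewrite /L1; clear -L0sk L00 sk0; lra.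
pose slip := slope_lip kappa T0; pose tlip := theta_lip kappa T0.
pose q0 := (kappa - 1) * T0.
have q00 : 0 < q0 := qmin_gt0 kappa1 T00.
have slip0 : 0 < slip := slope_lip_gt0 kappa1 T00.
have tlip0 : 0 < tlip := theta_lip_gt0 kappa1 T00.
have cP0 : 0 < 1 - (kappa ^+ 2 - 1) * L1 ^+ 2 by rewrite subr_gt0.
have kp : 0 < kappa by rewrite (lt_trans ltr01).
have t00 := tau0_gt0 hs.
(* [M1] to [M4] are the thresholds of the four conditions on [M] in [distance_estimate]; all are
   positive, so their sum with 1 exceeds each of them. *)
pose M1 := (slip + q0^-1) * (2 * Rm) ^+ 2 * delta / (L1 - L0).
pose M2 := 2 * (slip + tlip * W) / (c1 * (1 - (kappa ^+ 2 - 1) * L1 ^+ 2)).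
pose M3 := (kappa + 1) * (slip + q0^-1) * (2 * Rm + kappa * tau0)
   / (q0 * c1 * (1 - (kappa ^+ 2 - 1) * L1 ^+ 2)).
pose M4 := (2 * Rm) ^+ 2 * delta / mu0.
have Rm20 : 0 < (2 * Rm) ^+ 2 by rewrite exprn_gt0// mulr_gt0.
have sq0 : 0 < slip + q0^-1 by rewrite addr_gt0// invr_gt0.
have D10 : 0 < 2 * Rm + kappa * tau0 by rewrite addr_gt0 ?mulr_gt0.
have L10 : 0 < L1 - L0 by rewrite subr_gt0.
have M10 : 0 < M1 by apply: divr_gt0 => //; apply: mulr_gt0 => //; exact: mulr_gt0.
have c1P : 0 < c1 * (1 - (kappa ^+ 2 - 1) * L1 ^+ 2) by exact: mulr_gt0.
have q0c1P : 0 < q0 * c1 * (1 - (kappa ^+ 2 - 1) * L1 ^+ 2).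
  by apply: mulr_gt0 => //; exact: mulr_gt0.
have M20 : 0 < M2.
  apply: divr_gt0 => //; apply: mulr_gt0 => //; apply: addr_gt0 => //.
  exact: mulr_gt0.
have M30 : 0 < M3.
  apply: divr_gt0 => //; apply: mulr_gt0 => //; apply: mulr_gt0 => //.
  by rewrite addr_gt0.
have M40 : 0 < M4 by apply: divr_gt0 => //; exact: mulr_gt0.
pose M := 1 + M1 + M2 + M3 + M4.
have M0 : 0 < M by rewrite /M; clear -M10 M20 M30 M40; lra.
have half0 : 0 < delta / 2 by rewrite divr_gt0.
have ball : cball Xs.1 (3 / 2 * delta) `<=` Omega.
  move=> x xd; apply: rOO; apply: le_lt_trans xd _; rewrite /delta; clear -mO m0; lra.
have BO : eball Xs.1 (delta / 2) `<=` Omega.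
  by move=> x xd; apply: ball; move: xd; rewrite /eball /cball /=; clear -delta0; lra.
exists delta, M, c2; split; first by split.
move=> u sigma Ct C0 hu uXs _ Ct0 tg C00 sg.
have PX : P = Xs.2.
  by rewrite /P -uXs; have /andP[-> _] := hu.1 _ OXs.
have hZ Z : enorm (Z.1 - Xs.1) < delta / 2 -> `|Z.2 - Xs.2| <= 2 * L0 * delta ->
     [/\ U Z, Ur Z & 0 <= Z.2].
  move=> Z1 Z2; have Z3 := le_lt_trans Z2 mUP.
  move: Z3; rewrite lt_min => /andP[Z3 Z4].
  have [UZ UrZ] : (U `&` Ur) Z.
    by apply: rUU => //; apply: lt_le_trans Z1 _; rewrite /delta; clear -mU m0; lra.
  by split => //; move: Z4; rewrite PX ltr_norml => /andP[h _]; clear -h; lra.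
pose K := Num.max 1 (Num.max ((2 * M / delta) ^+ 2) ((2 * M / c2) ^+ 2)).
have K1 : 1 <= K by rewrite /K le_max lexx.
have K0 : 0 < K by exact: lt_le_trans K1.
have KM : (2 * M / delta) ^+ 2 <= K by rewrite /K !le_max lexx !orbT.
pose C1 := holder_constant n q C0 Ct M.
have C10 : 0 < C1 by exact: holder_constant_gt0.
have est (r : R) xb xh Yb Yh : eball Xs.1 (delta / 2) xb -> eball Xs.1 (delta / 2) xh ->
    refractor_map kappa Omega Sigma u xb Yb -> refractor_map kappa Omega Sigma u xh Yh ->
    0 < r -> enorm (xb - xh) <= r -> K * r <= enormX (Yb - Yh) ->
    enormX (Yb - Yh) <= C1 * r `^ a.
  move=> Bb Bh Fb Fh r0 rb Kr.
  have rd : r <= enormX (Yb - Yh) by apply: le_trans Kr; rewrite ler_peMl// ltW.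
  apply: solve_growth => //; first exact: lt_le_trans rd.
  apply: (@distance_estimate R n kappa tau0 tau1 omega Omega Sigma s hs T0 Rm b0 W L0
    T00 Rm0 b00 L00 adm diam kL0 slopeL0 u hu Xs U Ur c1 c2 delta L1 M mu0 Ct C0 q r
    sigma xb xh Yb Yh) => //.
  - by rewrite /M; clear -M10 M20 M30 M40; lra.
  - by rewrite [leRHS]mulrC -ler_pdivrMr// -/M1 /M; clear -M10 M20 M30 M40; lra.
  - by rewrite [leRHS]mulrC -ler_pdivrMr// -/M2 /M; clear -M10 M20 M30 M40; lra.
  - by rewrite [leRHS]mulrC -ler_pdivrMr// -/M3 /M; clear -M10 M20 M30 M40; lra.
  - by rewrite [leRHS]mulrC -ler_pdivrMr// -/M4 /M; clear -M10 M20 M30 M40; lra.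
  - by apply: le_trans Kr; rewrite ler_pM2r.
have main xb xh Yb Yh : eball Xs.1 (delta / 2) xb -> eball Xs.1 (delta / 2) xh ->
    refractor_map kappa Omega Sigma u xb Yb -> refractor_map kappa Omega Sigma u xh Yh ->
    K * enorm (xb - xh) <= enormX (Yb - Yh) ->
    enormX (Yb - Yh) <= C1 * enorm (xb - xh) `^ a.
  move=> Bb Bh Fb Fh Kr; have [r0|rn0] := eqVneq (enorm (xb - xh)) 0; last first.
    apply: (est _ _ _ _ _ Bb Bh Fb Fh _ (lexx _) Kr).
    by rewrite lt_def rn0 enorm_ge0.
  rewrite r0 powR0 ?gt_eqF// mulr0 leNgt; apply/negP => d0.
  set d := enormX (Yb - Yh) in d0 Kr.
  (* Equal base points: let the radius tend to 0. *)
  have e0 : 0 < d / (2 * C1) by rewrite divr_gt0// mulr_gt0.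
  pose r := Num.min (d / K) ((d / (2 * C1)) `^ a^-1).
  have r1 : 0 < r by rewrite lt_min divr_gt0//= powR_gt0.
  have rK : K * r <= d.
    by rewrite mulrC -ler_pdivlMr// /r ge_min lexx.
  have rC : C1 * r `^ a <= d / 2.
    have h : r `^ a <= d / (2 * C1).
      have -> : d / (2 * C1) = ((d / (2 * C1)) `^ a^-1) `^ a.
        by rewrite -powRrM mulVf ?gt_eqF// powRr1// ltW.
      apply: ge0_ler_powR; rewrite ?nnegrE ?powR_ge0 ?(ltW a0) ?(ltW r1)//.
      by rewrite /r ge_min lexx orbT.
    apply: le_trans (ler_wpM2l (ltW C10) h) _.
    by rewrite (_ : C1 * (d / (2 * C1)) = d / 2)//; field; rewrite gt_eqF.
  have := est r xb xh Yb Yh Bb Bh Fb Fh r1.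
  by rewrite r0 -/d => /(_ (ltW r1) rK); clear -rC d0; lra.
split; first exact: main.
apply: (refractor_C1_holder hs T00 b00 L00 adm diam slopeL0 hu (H := C1 + K)) => //.
- by rewrite a0.
- exact: addr_gt0.
- by rewrite /delta; clear -m1 m0; lra.
move=> x y Yx Yy Bx By Fx Fy; have w0 := enorm_ge0 (x - y).
(* Below the threshold the distance of the target points is already Lipschitz in the base points,
   with constant [K], which accounts for the constant [C1 + K]. *)
have [Kd|dK] := leP (K * enorm (x - y)) (enormX (Yx - Yy)).
  apply: le_trans (main _ _ _ _ Bx By Fx Fy Kd) _.
  by rewrite ler_wpM2r ?powR_ge0// lerDl ltW.
have w1 : enorm (x - y) <= 1.
  apply: le_trans (enorm_triangle x Xs.1 y) _; rewrite (enormB Xs.1 y).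
  by move: Bx By; rewrite /eball /= /delta; clear -m1; lra.
have wa : enorm (x - y) <= enorm (x - y) `^ a.
  have [->|wn0] := eqVneq (enorm (x - y)) 0; first exact: powR_ge0.
  rewrite -[leLHS]powRr1//; apply: ger_powR => //.
  by rewrite lt_def wn0 w0.
apply: le_trans (ltW dK) _; rewrite mulrDl.
have h1 := ler_wpM2l (ltW K0) wa.
have h2 : 0 <= C1 * enorm (x - y) `^ a by rewrite mulr_ge0 ?powR_ge0// ltW.
clear -h1 h2; lra.
Qed.
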